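(* Let $K$ be a non-archimedean local field with discrete valuation $v$, and let $p$ be the characteristic of its residue field. Let $G=\langle A,B\rangle$ be a discrete, non-elementary subgroup of $\mathrm{SL}_2(K)$. If $K=\mathbb{Q}_p$, or $G$ contains no elements of order $p$, then $$\min\{v(\mathrm{tr}^2(A)-4),\ v(\mathrm{tr}([A,B])-2)\}\le 0.$$ Moreover, equality holds if and only if $A$ is elliptic of finite order, $B$ is hyperbolic, and the fixed point set of $A$ in $T_K$ intersects the translation axis of $B$ in a finite path whose length equals the translation length of $B$.
   Context: A non-archimedean local field is a finite extension of $\mathbb{Q}_p$ or $\mathbb{F}_q((t))$. $T_K$ is the Bruhat–Tits tree of $\mathrm{SL}_2(K)$ (edges of length 1), on which $\mathrm{SL}_2(K)$ acts by isometries without inversions; each element is elliptic (fixes a vertex) or hyperbolic (translates along a bi-infinite geodesic, its axis, by its translation length $>0$). $\mathrm{SL}_2(K)$ has the subspace topology from $K^4$. A subgroup is elementary if it stabilises a vertex, an end, or a pair of ends of $T_K$, and non-elementary otherwise. $[A,B]=ABA^{-1}B^{-1}$. *)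

(* Defs.v *)
From HB Require Import structures.
From mathcomp Require Import all_boot all_order all_algebra.
Set Implicit Arguments.
Unset Strict Implicit.
Unset Printing Implicit Defensive.
Import Order.TTheory GRing.Theory Num.Theory.
Local Open Scope ring_scope.

(* Extended integers: [None] stands for +oo (the valuation of 0). *)
Definition ole (a b : option int) : bool :=
  match a, b with
  | _, None => true
  | None, Some _ => false
  | Some x, Some y => (x <= y)%R
  end.
Definition omin (a b : option int) : option int := if ole a b then a else b.
Definition oadd (a b : option int) : option int :=
  match a, b with Some x, Some y => Some (x + y) | _, _ => None end.

Section LocalField.
Variables (K : fieldType) (v : K -> option int).

Definition vge (x : K) (n : int) : bool := ole (Some n) (v x).

Record nonarch_local_field (p : nat) : Prop := {
  nlf_zero : forall x, v x = None <-> x = 0;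
  nlf_mul : forall x y, v (x * y) = oadd (v x) (v y);
  nlf_add : forall x y, ole (omin (v x) (v y)) (v (x + y));
  nlf_surj : forall n : int, exists x, v x = Some n;
  nlf_complete : forall u : nat -> K,
      (forall n : int, exists N, forall i j, (N <= i)%N -> (N <= j)%N ->
          vge (u i - u j) n) ->
      exists l, forall n : int, exists N, forall i, (N <= i)%N -> vge (u i - l) n;
  nlf_residue_finite : exists s : seq K, (forall x, x \in s -> vge x 0) /\
      (forall x, vge x 0 -> exists2 y, y \in s & vge (x - y) 1);
  nlf_prime : prime p;
  nlf_res_char : vge (p%:R) 1
}.

(* K = Q_p: K has characteristic 0 and is the completion of Q for v,
   i.e. Q is dense in K. *)
Definition is_Qp : Prop :=
  (forall n : nat, (n.+1)%:R != 0 :> K) /\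
  (forall (x : K) (n : int), exists q : rat, vge (x - ratr q) n).

Definition intmx (N : 'M[K]_2) : Prop := forall i j, vge (N i j) 0.

(* Vertices of T_K: homothety classes of O-lattices M O^2 in K^2, represented
   by basis matrices M in GL_2(K). *)
Definition isvert (M : 'M[K]_2) : Prop := \det M != 0.

(* Same homothety class: c M' O^2 = M O^2 for some c in K^*. *)
Definition lat_eq (M M' : 'M[K]_2) : Prop :=
  exists c : K, c != 0 /\
    intmx (invmx M *m (c *: M')) /\ intmx (invmx (invmx M *m (c *: M'))).

(* Edges: classes with representatives pi L < L' < L (strict inclusions). *)
Definition adj (M M' : 'M[K]_2) : Prop :=
  exists c : K, c != 0 /\
    let N := invmx M *m (c *: M') in
    intmx N /\ (forall i j, vge (invmx N i j) (-1)) /\ v (\det N) = Some 1.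

Definition reach (M M' : 'M[K]_2) (n : nat) : Prop :=
  exists s : nat -> 'M[K]_2, (forall i, isvert (s i)) /\ s 0%N = M /\ s n = M' /\
    forall i, (i < n)%N -> adj (s i) (s i.+1).

Definition tdist (M M' : 'M[K]_2) (n : nat) : Prop :=
  reach M M' n /\ forall m, reach M M' m -> (n <= m)%N.

Definition fixes (g M : 'M[K]_2) : Prop := lat_eq (g *m M) M.

Definition elliptic (g : 'M[K]_2) : Prop := exists M, isvert M /\ fixes g M.

Definition geod_line (f : int -> 'M[K]_2) : Prop :=
  (forall i, isvert (f i)) /\ forall i j, tdist (f i) (f j) `|i - j|%N.

Definition hyp_axis (g : 'M[K]_2) (f : int -> 'M[K]_2) (l : nat) : Prop :=
  geod_line f /\ (0 < l)%N /\ forall i, lat_eq (g *m f i) (f (i + l%:Z)).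

Definition geod_ray (r : nat -> 'M[K]_2) : Prop :=
  (forall i, isvert (r i)) /\ forall i j, tdist (r i) (r j) `|(i%:Z - j%:Z)|%N.

Definition ray_equiv (r r' : nat -> 'M[K]_2) : Prop :=
  exists k m : nat, forall i, lat_eq (r (i + k)%N) (r' (i + m)%N).

Definition elementary (G : 'M[K]_2 -> Prop) : Prop :=
  (exists M, isvert M /\ forall g, G g -> fixes g M) \/
  (exists r, geod_ray r /\
     forall g, G g -> ray_equiv (fun i => g *m r i) r) \/
  (exists r1 r2, geod_ray r1 /\ geod_ray r2 /\ ~ ray_equiv r1 r2 /\
     forall g, G g ->
       (ray_equiv (fun i => g *m r1 i) r1 /\ ray_equiv (fun i => g *m r2 i) r2) \/
       (ray_equiv (fun i => g *m r1 i) r2 /\ ray_equiv (fun i => g *m r2 i) r1)).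

Definition discrete (G : 'M[K]_2 -> Prop) : Prop :=
  forall g, G g -> exists n : int, forall h, G h ->
    (forall i j, vge (h i j - g i j) n) -> h = g.

End LocalField.

Inductive gen (K : fieldType) (A B : 'M[K]_2) : 'M[K]_2 -> Prop :=
| gen1 : gen A B 1%:M
| genA : gen A B A
| genB : gen A B B
| genAi : gen A B (invmx A)
| genBi : gen A B (invmx B)
| genM g h : gen A B g -> gen A B h -> gen A B (g *m h).

Definition comm (K : fieldType) (A B : 'M[K]_2) : 'M[K]_2 :=
  A *m B *m invmx A *m invmx B.

(* Main.v *)
Require Import Defs.
From HB Require Import structures.
From mathcomp Require Import all_boot all_order all_algebra.
From mathcomp Require Import ring zify.
Set Implicit Arguments.
Unset Strict Implicit.
Unset Printing Implicit Defensive.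
Import Order.TTheory GRing.Theory Num.Theory.
Local Open Scope ring_scope.

(** Write t, s, u for the traces of A, B, AB, so that
    tr [A,B] - 2 = s^2 - t s u + u^2 + (t^2 - 4), and suppose that both
    quantities in the minimum are integral.  If s were integral, so would be u,
    and O + OA + OB + OAB would be an order fixing a vertex; hence B is
    hyperbolic.  In a basis of eigenvectors of B, with A = [[a, b], [c, d]] and
    eigenvalues x^-1, x of B, v x = n > 0, one gets
    tr [A,B] - 2 = - b c (x^-1 - x)^2, so v(bc) >= 2n, while A fixes exactly the
    vertices - v b <= i <= v c of the axis of B, whose translation length is 2n.
    Discreteness makes every residually unipotent element of G a torsion
    element of p-power order.  Applied to A^2 this gives v(t^2 - 4) = 0, and
    applied to [A, B A B^-1], which lies in an Iwahori subgroup as soon as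
    v(bc) > 2n, it gives v(bc) = 2n.  In Q_p the p-torsion that may interfere
    only exists for p <= 3 and is handled by a parity argument on valuations. *)

(** * Two-by-two matrices *)
Section Matrix2.
Variable K : fieldType.
Implicit Types (M N : 'M[K]_2).

(** Torsion comes out of discreteness because the p-th power of a residually unipotent g is strictly
    closer to 1: the powers g^(p^j) enter every neighbourhood of 1, so one of them equals 1. If G
    has no element of order p, then g = 1. Over Q_p torsion must be tolerated, but a primitive p-th
    root of unity has degree p - 1 and an eigenvalue of a 2 by 2 matrix has degree at most 2, so p
    <= 3. The two places where it could interfere need different remedies. For v(t^2 - 4), the form
    r^2 - t r + 1 at r = u / s would have valuation at least 2n >= 2, which is impossible for the
    exceptional traces t. For v(bc), every unit of Q_p squares to 1 in the residue field when p <=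
    3, which would push t^2 - 4 into the maximal ideal. The conjugate B A B^-1 is chosen because it
    has the same diagonal as A and fixes the translate by B of the path fixed by A; the two paths
    share an edge exactly when v(bc) > 2n. *)

Definition mat2 (a b c d : K) : 'M[K]_2 :=
  \matrix_(i, j) (if i == 0 then if j == 0 then a else b
                  else if j == 0 then c else d).

Lemma ord2P (i : 'I_2) : i = 0 \/ i = 1.
Proof. by case: i => [[|[|i]] Hi] //; [left|right]; apply: val_inj. Qed.

Lemma mx2_eqP M N :
  M 0 0 = N 0 0 -> M 0 1 = N 0 1 -> M 1 0 = N 1 0 -> M 1 1 = N 1 1 -> M = N.
Proof.
move=> h00 h01 h10 h11; apply/matrixP => i j.
by case: (ord2P i) => ->; case: (ord2P j) => ->.
Qed.

Lemma mat2_eta M : M = mat2 (M 0 0) (M 0 1) (M 1 0) (M 1 1).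
Proof. by apply: mx2_eqP; rewrite !mxE. Qed.

Lemma mat2_inj a b c d a' b' c' d' :
  mat2 a b c d = mat2 a' b' c' d' -> [/\ a = a', b = b', c = c' & d = d'].
Proof.
move=> /matrixP h; split.
- by have := h 0 0; rewrite !mxE.
- by have := h 0 1; rewrite !mxE.
- by have := h 1 0; rewrite !mxE.
- by have := h 1 1; rewrite !mxE.
Qed.

Lemma mul_mat2 a b c d a' b' c' d' :
  mat2 a b c d *m mat2 a' b' c' d' =
  mat2 (a * a' + b * c') (a * b' + b * d') (c * a' + d * c') (c * b' + d * d').
Proof. by apply: mx2_eqP; rewrite !mxE !big_ord_recl big_ord0 !mxE /= addr0. Qed.

Lemma add_mat2 a b c d a' b' c' d' :
  mat2 a b c d + mat2 a' b' c' d' = mat2 (a + a') (b + b') (c + c') (d + d').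
Proof. by apply: mx2_eqP; rewrite !mxE. Qed.

Lemma opp_mat2 a b c d : - mat2 a b c d = mat2 (- a) (- b) (- c) (- d).
Proof. by apply: mx2_eqP; rewrite !mxE. Qed.

Lemma scale_mat2 x a b c d :
  x *: mat2 a b c d = mat2 (x * a) (x * b) (x * c) (x * d).
Proof. by apply: mx2_eqP; rewrite !mxE. Qed.

Lemma scalar_mat2 a : a%:M = mat2 a 0 0 a.
Proof. by apply: mx2_eqP; rewrite !mxE ?mulr1n ?mulr0n. Qed.

Lemma tr_mat2 a b c d : \tr (mat2 a b c d) = a + d.
Proof. by rewrite /mxtrace !big_ord_recl big_ord0 !mxE /= addr0. Qed.

Lemma det_mat2 a b c d : \det (mat2 a b c d) = a * d - b * c.
Proof.
rewrite (expand_det_row _ 0) !big_ord_recl big_ord0 /cofactor !det_mx11 !mxE /=.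
by rewrite /bump /= expr0 expr1; ring.
Qed.

Lemma invmx_mat2 a b c d : a * d - b * c != 0 ->
  invmx (mat2 a b c d) = (a * d - b * c)^-1 *: mat2 d (- b) (- c) a.
Proof.
move=> h; have hu : mat2 a b c d \in unitmx by rewrite unitmxE det_mat2 unitfE.
have e : mat2 a b c d *m ((a * d - b * c)^-1 *: mat2 d (- b) (- c) a) = 1%:M.
  rewrite scale_mat2 mul_mat2 scalar_mat2.
  by congr mat2; field.
by rewrite -[RHS](mulKmx hu) e mulmx1.
Qed.

Lemma unitmx_det M : (M \in unitmx) = (\det M != 0).
Proof. by rewrite unitmxE unitfE. Qed.

Lemma invmx_mul M N : \det M != 0 -> \det N != 0 ->
  invmx (M *m N) = invmx N *m invmx M.
Proof.
move=> hM hN; have hu : M *m N \in unitmx by rewrite unitmx_det det_mulmx mulf_neq0.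
rewrite -[RHS](mulmxK hu) -!mulmxA (mulmxA _ M) mulVmx ?unitmx_det // mul1mx.
by rewrite mulmxA mulVmx ?unitmx_det // mul1mx.
Qed.

Lemma invmx_adj M : \det M = 1 -> invmx M = (\tr M)%:M - M.
Proof.
rewrite (mat2_eta M) det_mat2 tr_mat2 => h.
rewrite invmx_mat2 h ?oner_eq0 // invr1 scale1r scalar_mat2 opp_mat2 add_mat2.
by congr mat2; ring.
Qed.

Lemma invmx_10 M : \det M = 1 -> invmx M 1 0 = - M 1 0.
Proof. by move=> h; rewrite invmx_adj // !mxE mulr0n sub0r. Qed.

Lemma cayley_hamilton2 M : M *m M = (\tr M) *: M - (\det M)%:M.
Proof.
rewrite (mat2_eta M) tr_mat2 det_mat2 mul_mat2 scale_mat2 scalar_mat2 opp_mat2.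
by rewrite add_mat2; congr mat2; ring.
Qed.

Lemma det1_mul M N : \det M = 1 -> \det N = 1 -> \det (M *m N) = 1.
Proof. by move=> hM hN; rewrite det_mulmx hM hN mulr1. Qed.

Lemma det1_inv M : \det M = 1 -> \det (invmx M) = 1.
Proof. by move=> h; rewrite det_inv h invr1. Qed.

Lemma gen_det1 (A B : 'M[K]_2) : \det A = 1 -> \det B = 1 ->
  forall g, gen A B g -> \det g = 1.
Proof.
move=> hA hB g; elim=> {g} //; rewrite ?det1 //; first exact: det1_inv.
  exact: det1_inv.
by move=> g h _ hg _ hh; apply: det1_mul.
Qed.

Definition conjm P M : 'M[K]_2 := invmx P *m M *m P.

Lemma tr_conjm P M : \det P != 0 -> \tr (conjm P M) = \tr M.
Proof. by move=> h; rewrite mxtrace_mulC mulmxA mulmxV ?mul1mx ?unitmx_det. Qed.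

Lemma det_conjm P M : \det P != 0 -> \det (conjm P M) = \det M.
Proof. by move=> h; rewrite !det_mulmx det_inv mulrAC mulVf ?mul1r. Qed.

Lemma conjmM P M N : \det P != 0 -> conjm P (M *m N) = conjm P M *m conjm P N.
Proof. by move=> h; rewrite /conjm !mulmxA mulmxK ?unitmx_det. Qed.

Lemma conjmD P M N : conjm P (M + N) = conjm P M + conjm P N.
Proof. by rewrite /conjm mulmxDr mulmxDl. Qed.

Lemma conjmZ P x M : conjm P (x *: M) = x *: conjm P M.
Proof. by rewrite /conjm -scalemxAr -scalemxAl. Qed.

Lemma conjm_scalar P x : \det P != 0 -> conjm P x%:M = x%:M.
Proof.
by move=> h; rewrite /conjm mul_mx_scalar -scalemxAl mulVmx ?unitmx_det ?scalemx1.
Qed.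

Lemma conjmX P M n : \det P != 0 -> conjm P (M ^+ n) = conjm P M ^+ n.
Proof.
move=> h; elim: n => [|n IH]; first by rewrite !expr0 conjm_scalar.
by rewrite !exprS -!mulmxE conjmM // IH.
Qed.

Lemma conjmN P M : conjm P (- M) = - conjm P M.
Proof. by rewrite -scaleN1r conjmZ scaleN1r. Qed.

Lemma conjmVK P M : \det P != 0 -> P *m conjm P M *m invmx P = M.
Proof.
by move=> h; rewrite /conjm !mulmxA mulmxV ?unitmx_det // mul1mx mulmxK ?unitmx_det.
Qed.

Lemma conjm_comp P Q M : \det P != 0 -> \det Q != 0 ->
  conjm (P *m Q) M = conjm Q (conjm P M).
Proof.
by move=> hP hQ; rewrite /conjm invmx_mul // !mulmxA.
Qed.

Lemma conjm_inv P M : \det P != 0 -> \det M = 1 ->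
  conjm P (invmx M) = invmx (conjm P M).
Proof.
move=> h hM; rewrite !invmx_adj ?det_conjm // tr_conjm // conjmD conjmN.
by rewrite conjm_scalar.
Qed.

(** The Fricke identity. Inverses are replaced by adjugates, and the two determinant equations are
    handed to [ring] as rewriting rules. *)
Lemma tr_comm (A B : 'M[K]_2) : \det A = 1 -> \det B = 1 ->
  \tr (comm A B) - 2%:R = \tr B ^+ 2 - \tr A * \tr B * \tr (A *m B)
     + \tr (A *m B) ^+ 2 + (\tr A ^+ 2 - 4%:R).
Proof.
move=> hA hB; rewrite /comm !invmx_adj //; move: hA hB.
rewrite (mat2_eta A) (mat2_eta B).
move: (A 0 0) (A 0 1) (A 1 0) (A 1 1) (B 0 0) (B 0 1) (B 1 0) (B 1 1).
move=> a b c d x y z w; rewrite !det_mat2 => hA hB.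
rewrite !scalar_mat2 !opp_mat2 !add_mat2 !tr_mat2 !mul_mat2 !tr_mat2.
have {}hA : a * d = 1 + b * c by rewrite -hA; ring.
have {}hB : x * w = 1 + y * z by rewrite -hB; ring.
by ring: hA hB.
Qed.

Lemma mulmx_col0 M (y : 'cV[K]_2) : (M *m y) 0 0 = M 0 0 * y 0 0 + M 0 1 * y 1 0.
Proof.
rewrite !mxE !big_ord_recl big_ord0 addr0.
by rewrite (_ : lift ord0 ord0 = 1) //; apply: val_inj.
Qed.

Lemma mulmx_col1 M (y : 'cV[K]_2) : (M *m y) 1 0 = M 1 0 * y 0 0 + M 1 1 * y 1 0.
Proof.
rewrite !mxE !big_ord_recl big_ord0 addr0.
by rewrite (_ : lift ord0 ord0 = 1) //; apply: val_inj.
Qed.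

(** The quantity is the determinant of the pair (e, M e), so e is a cyclic vector; one of the two
    basis vectors or their sum always works. *)
Lemma nonscalar_vec M : M != (M 0 0)%:M ->
  exists e : 'cV[K]_2, e 0 0 * (M *m e) 1 0 - (M *m e) 0 0 * e 1 0 != 0.
Proof.
move=> h; have [h10|h10] := eqVneq (M 1 0) 0; last first.
  exists (\col_i (i == 0)%:R); rewrite mulmx_col0 mulmx_col1 !mxE /=.
  by rewrite !(mulr0, mulr1, mul1r, addr0, subr0).
have [h01|h01] := eqVneq (M 0 1) 0; last first.
  exists (\col_i (i == 1)%:R); rewrite mulmx_col0 mulmx_col1 !mxE /=.
  by rewrite !(mulr0, mulr1, mul0r, add0r, sub0r) oppr_eq0.
exists (\col_i 1); rewrite mulmx_col0 mulmx_col1 !mxE h01 h10.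
rewrite !(mulr1, mul1r, addr0, add0r) subr_eq0.
apply: contra h => /eqP e; apply/eqP.
by apply: mx2_eqP; rewrite !mxE ?mulr1n ?mulr0n.
Qed.

End Matrix2.

(** * The valuation *)
Section Valuation.
Variables (K : fieldType) (v : K -> option int) (p : nat).
Hypothesis HK : nonarch_local_field v p.
Implicit Types (x y : K) (m n : int).

Lemma nval0 : v 0 = None.
Proof. by apply/(nlf_zero HK). Qed.

Lemma nval_neq0 x : x != 0 -> exists n, v x = Some n.
Proof.
case e : (v x) => [n|]; first by exists n.
by move/(nlf_zero HK): e => ->; rewrite eqxx.
Qed.

Lemma neq0_nval x n : v x = Some n -> x != 0.
Proof. by move=> e; apply/eqP => x0; move: e; rewrite x0 nval0. Qed.

Lemma nvalM x y m n : v x = Some m -> v y = Some n -> v (x * y) = Some (m + n).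
Proof. by rewrite (nlf_mul HK) => -> ->. Qed.

Lemma nval1 : v 1 = Some 0.
Proof.
have [n e] := nval_neq0 (oner_neq0 K).
have := nlf_mul HK 1 1; rewrite mulr1 e => -[] h; congr Some; lia.
Qed.

Lemma nvalN1 : v (-1) = Some 0.
Proof.
have h : (-1 : K) != 0 by rewrite oppr_eq0 oner_neq0.
have [n e] := nval_neq0 h.
have := nlf_mul HK (-1) (-1); rewrite mulrNN mulr1 e nval1 => -[] h'.
by congr Some; lia.
Qed.

Lemma nvalN x : v (- x) = v x.
Proof.
rewrite -mulN1r (nlf_mul HK) nvalN1 /=.
by case: (v x) => // n; rewrite add0r.
Qed.

Lemma nvalV x n : v x = Some n -> v x^-1 = Some (- n).
Proof.
move=> e; have hx := neq0_nval e.
have [m em] : exists m, v x^-1 = Some m by apply: nval_neq0; rewrite invr_eq0.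
have := nvalM e em; rewrite mulfV // nval1 em => -[] h; congr Some; lia.
Qed.

Lemma nvalX x n (k : nat) : v x = Some n -> v (x ^+ k) = Some (n * k%:Z).
Proof.
move=> e; elim: k => [|k IH]; first by rewrite expr0 nval1 mulr0.
by rewrite exprS (nvalM e IH); congr Some; lia.
Qed.

Lemma vge_nval x n m : v x = Some n -> vge v x m = (m <= n).
Proof. by rewrite /vge => ->. Qed.

Lemma vge_zero m : vge v 0 m.
Proof. by rewrite /vge nval0. Qed.

Lemma vge_le x m n : n <= m -> vge v x m -> vge v x n.
Proof. by rewrite /vge; case: (v x) => //= k; lia. Qed.

Lemma vgeD x y m : vge v x m -> vge v y m -> vge v (x + y) m.
Proof.
have := nlf_add HK x y; rewrite /vge /omin.
case: (v x) => [a|] /=; case: (v y) => [b|] /=; case: (v (x + y)) => [c|] //=;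
  try case: ifP => /=; lia.
Qed.

Lemma vgeN x m : vge v (- x) m = vge v x m.
Proof. by rewrite /vge nvalN. Qed.

Lemma vgeB x y m : vge v x m -> vge v y m -> vge v (x - y) m.
Proof. by move=> hx hy; apply: vgeD; rewrite ?vgeN. Qed.

Lemma vgeM x y m n k : vge v x m -> vge v y n -> k <= m + n -> vge v (x * y) k.
Proof.
rewrite /vge (nlf_mul HK); case: (v x) => [a|] //=; case: (v y) => [b|] //=; lia.
Qed.

Lemma vgeMl x y m : vge v x 0 -> vge v y m -> vge v (x * y) m.
Proof. by move=> hx hy; apply: vgeM hx hy _; rewrite add0r. Qed.

Lemma vgeMr x y m : vge v x m -> vge v y 0 -> vge v (x * y) m.
Proof. by move=> hx hy; apply: vgeM hx hy _; rewrite addr0. Qed.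

Lemma vge1 m : vge v 1 m = (m <= 0).
Proof. exact: vge_nval nval1. Qed.

Lemma vge_nat (n : nat) : vge v n%:R 0.
Proof.
elim: n => [|n IH]; first exact: vge_zero.
by rewrite -natr1 vgeD // vge1.
Qed.

Lemma vgeX x m (k : nat) : vge v x m -> vge v (x ^+ k) (m * k%:Z).
Proof.
move=> hx; elim: k => [|k IH]; first by rewrite expr0 vge1; lia.
by rewrite exprS; apply: vgeM hx IH _; lia.
Qed.

Lemma vgeXint x (k : nat) : vge v x 0 -> vge v (x ^+ k) 0.
Proof. by move=> hx; have := vgeX k hx; rewrite mul0r. Qed.

Lemma nval_dom x y n : v x = Some n -> vge v y (n + 1) -> v (x + y) = Some n.
Proof.
move=> ex hy; have hxn : vge v x n by rewrite (vge_nval _ ex).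
have h1 : vge v (x + y) n by apply: vgeD => //; apply: vge_le hy; lia.
have h2 : ~~ vge v (x + y) (n + 1).
  apply/negP => h; have := vgeB h hy; rewrite addrK (vge_nval _ ex); lia.
move: h1 h2; rewrite /vge; case: (v (x + y)) => //= m h1 h2.
by congr Some; lia.
Qed.

Lemma vge_unit_nval x : vge v x 0 -> ~~ vge v x 1 -> v x = Some 0.
Proof. by rewrite /vge; case: (v x) => //= n h1 h2; congr Some; lia. Qed.

Lemma nvge_nval x m : ~~ vge v x m -> exists2 n, v x = Some n & n < m.
Proof. by rewrite /vge; case: (v x) => //= n h; exists n => //; lia. Qed.

Lemma vge_zeroP x : (forall k : nat, vge v x k%:Z) -> x = 0.
Proof.
move=> h; apply/(nlf_zero HK); case e : (v x) => [n|] //.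
by have := h (`|n|.+1)%N; rewrite (vge_nval _ e); lia.
Qed.

(** The valuation ring is integrally closed: if v x were negative, x^2 would strictly dominate the
    other two terms. *)
Lemma vge_monic2 x b c : vge v b 0 -> vge v c 0 ->
  vge v (x ^+ 2 - b * x + c) 0 -> vge v x 0.
Proof.
move=> hb hc h; case: (boolP (vge v x 0)) => // /nvge_nval [n ex ln].
have e2 : v (x ^+ 2) = Some (n + n) by rewrite expr2; apply: nvalM.
have hbx : vge v (b * x) n by apply: vgeMl => //; rewrite (vge_nval _ ex).
have : v (x ^+ 2 + (c - b * x)) = Some (n + n).
  apply: nval_dom => //; apply: vgeB; first by apply: vge_le hc; lia.
  by apply: vge_le hbx; lia.
have -> : x ^+ 2 + (c - b * x) = x ^+ 2 - b * x + c by ring.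
by move=> e; move: h; rewrite (vge_nval _ e); lia.
Qed.

Lemma vge_sum_prod x y : vge v (x + y) 0 -> vge v (x * y) 0 -> vge v x 0.
Proof.
move=> hs hp; apply: (vge_monic2 hs hp).
have -> : x ^+ 2 - (x + y) * x + x * y = 0 by ring.
exact: vge_zero.
Qed.

Lemma nval_neq_odd x y (k : int) : v y = Some (k * 2%:Z + 1) -> x ^+ 2 <> y.
Proof.
move=> ey exy; have x0 : x != 0.
  by apply/eqP => x0; move: ey; rewrite -exy x0 expr0n nval0.
have [n en] := nval_neq0 x0.
by have := nvalX 2 en; rewrite exy ey => -[] h; lia.
Qed.

(** * Integral matrices and stabilisers of vertices *)
Implicit Types (M N g : 'M[K]_2).

Lemma intmx_mat2 a b c d : intmx v (mat2 a b c d) <->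
  [/\ vge v a 0, vge v b 0, vge v c 0 & vge v d 0].
Proof.
split=> [h|[ha hb hc hd] i j]; last by rewrite mxE; do 2?case: ifP.
split.
- by have := h 0 0; rewrite mxE.
- by have := h 0 1; rewrite mxE.
- by have := h 1 0; rewrite mxE.
- by have := h 1 1; rewrite mxE.
Qed.

(** Rectangular, so that it covers column vectors too; the level k expresses congruences modulo
    powers of the maximal ideal. *)
Definition mxge (a b : nat) k (X : 'M[K]_(a, b)) : Prop := forall i j, vge v (X i j) k.

Lemma mxgeD (a b : nat) k (X Y : 'M[K]_(a, b)) : mxge k X -> mxge k Y -> mxge k (X + Y).
Proof. by move=> hX hY i j; rewrite mxE vgeD. Qed.

Lemma mxgeN (a b : nat) k (X : 'M[K]_(a, b)) : mxge k X -> mxge k (- X).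
Proof. by move=> hX i j; rewrite mxE vgeN. Qed.

Lemma mxgeB (a b : nat) k (X Y : 'M[K]_(a, b)) : mxge k X -> mxge k Y -> mxge k (X - Y).
Proof. by move=> hX hY; apply: mxgeD => //; apply: mxgeN. Qed.

Lemma mxge_le (a b : nat) k l (X : 'M[K]_(a, b)) : l <= k -> mxge k X -> mxge l X.
Proof. by move=> h hX i j; apply: vge_le h _. Qed.

Lemma mxgeZ (a b : nat) k l x (X : 'M[K]_(a, b)) :
  vge v x k -> mxge l X -> mxge (k + l) (x *: X).
Proof. by move=> hx hX i j; rewrite mxE; apply: vgeM hx (hX i j) _. Qed.

Lemma mxgeM (a b q : nat) k l r (X : 'M[K]_(a, b)) (Y : 'M[K]_(b, q)) :
  mxge k X -> mxge l Y -> r <= k + l -> mxge r (X *m Y).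
Proof.
move=> hX hY h i j; rewrite mxE; apply: (big_ind (fun z => vge v z r)) => [||s _].
- exact: vge_zero.
- by move=> x y; apply: vgeD.
- exact: vgeM (hX i s) (hY s j) h.
Qed.

(** Bounds the precision lost when a congruence is conjugated by a fixed matrix. *)
Lemma mxge_bound (a b : nat) (X : 'M[K]_(a, b)) : exists k : nat, mxge (- k%:Z) X.
Proof.
pose w (x : K) : nat := if v x is Some n then `|n|%N else 0%N.
exists (\big[maxn/0%N]_i \big[maxn/0%N]_j w (X i j)) => i j.
have h : (w (X i j) <= \big[maxn/0%N]_i \big[maxn/0%N]_j w (X i j))%N.
  by apply: leq_trans (leq_bigmax_cond i _) => //; apply: leq_trans (leq_bigmax_cond j _).
rewrite /vge; move: h; rewrite {1}/w; case: (v (X i j)) => //= n; lia.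
Qed.

Lemma intmxM M N : intmx v M -> intmx v N -> intmx v (M *m N).
Proof. by move=> hM hN; apply: (mxgeM hM hN). Qed.

Lemma intmx_scalar x : vge v x 0 -> intmx v (x%:M).
Proof. by move=> hx; rewrite scalar_mat2; apply/intmx_mat2; rewrite vge_zero. Qed.

Lemma intmxZ x M : vge v x 0 -> intmx v M -> intmx v (x *: M).
Proof. by move=> hx hM; apply: (mxgeZ hx hM). Qed.

Lemma intmxX M (k : nat) : intmx v M -> intmx v (M ^+ k).
Proof.
move=> hM; elim: k => [|k IH]; first by rewrite expr0; apply: intmx_scalar; rewrite vge1.
by rewrite exprS; apply: intmxM.
Qed.

Lemma intmx_tr M : intmx v M -> vge v (\tr M) 0.
Proof. by rewrite {1}(mat2_eta M) => /intmx_mat2[*]; rewrite (mat2_eta M) tr_mat2 vgeD. Qed.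

Lemma intmx_det M : intmx v M -> vge v (\det M) 0.
Proof.
by rewrite {1}(mat2_eta M) => /intmx_mat2[*]; rewrite (mat2_eta M) det_mat2 vgeB // vgeMl.
Qed.

Lemma intmx_inv M : v (\det M) = Some 0 -> intmx v M -> intmx v (invmx M).
Proof.
move=> hd; have := neq0_nval hd; move: hd; rewrite (mat2_eta M) det_mat2 => hd d0.
rewrite invmx_mat2 // => /intmx_mat2[*]; apply: intmxZ.
  by rewrite (vge_nval _ (nvalV hd)) oppr0.
by apply/intmx_mat2; rewrite !vgeN.
Qed.

Lemma lat_eqI M M' (c : K) : c != 0 -> intmx v (invmx M *m (c *: M')) ->
  v (\det (invmx M *m (c *: M'))) = Some 0 -> lat_eq v M M'.
Proof. by move=> hc h1 h2; exists c; split=> //; split=> //; apply: intmx_inv. Qed.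

(** Determinant 1 forces the homothety factor to be a unit, so an element that fixes the class of a
    lattice stabilises the lattice itself. *)
Lemma fixesP g M : \det g = 1 -> \det M != 0 -> fixes v g M <-> intmx v (conjm M g).
Proof.
move=> hg hM; have hMu : M \in unitmx by rewrite unitmx_det.
have dg : \det (conjm M g) = 1 by rewrite det_conjm.
have hinv : invmx (g *m M) = invmx M *m invmx g by rewrite invmx_mul ?hg ?oner_neq0.
have E c : invmx (g *m M) *m (c *: M) = c *: invmx (conjm M g).
  by rewrite hinv -scalemxAr -conjm_inv.
split=> [[c [c0 []]]|h]; rewrite ?E.
  move=> h1 h2; have d0 : \det (c *: invmx (conjm M g)) != 0.
    by rewrite detZ det1_inv // mulr1 expf_eq0 (negbTE c0).
  have := intmx_det h2; have := intmx_det h1.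
  rewrite det_inv !detZ det1_inv // mulr1; have [n en] := nval_neq0 c0.
  rewrite (vge_nval _ (nvalX 2 en)) (vge_nval _ (nvalV (nvalX 2 en))) => ha hb.
  have n0 : n = 0 by lia.
  have hci : vge v c^-1 0 by rewrite (vge_nval _ (nvalV en)) n0.
  have := intmxZ hci h1; rewrite scalerA mulVf // scale1r => h3.
  have di : v (\det (invmx (conjm M g))) = Some 0 by rewrite det1_inv // nval1.
  by have := intmx_inv di h3; rewrite invmxK.
apply: (lat_eqI (c := 1)); rewrite ?oner_neq0 ?E ?scale1r //.
  by apply: intmx_inv; rewrite // dg nval1.
by rewrite det1_inv // nval1.
Qed.

Lemma elliptic_tr g : \det g = 1 -> elliptic v g -> vge v (\tr g) 0.
Proof.
move=> hg [M [hM /(fixesP hg hM) h]].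
by rewrite -(tr_conjm g hM); apply: intmx_tr.
Qed.

(* Among all pairs of vectors of the family take one whose determinant has
   minimal valuation: by Cramer's rule the other vectors are integral
   combinations of it. *)
Lemma lattice_of_family (n : nat) (x : 'I_n -> 'cV[K]_2) (i0 j0 : 'I_n) :
  x i0 0 0 * x j0 1 0 - x j0 0 0 * x i0 1 0 != 0 ->
  exists M, [/\ isvert M, forall i, mxge 0 (invmx M *m x i) &
    forall g, (forall i, mxge 0 (invmx M *m (g *m x i))) -> intmx v (conjm M g)].
Proof.
pose D (i j : 'I_n) := x i 0 0 * x j 1 0 - x j 0 0 * x i 1 0.
move=> h0.
have [[i j] [hij hmin]] : exists ij : 'I_n * 'I_n, D ij.1 ij.2 != 0 /\
    forall k l, D k l != 0 -> exists2 m, v (D ij.1 ij.2) = Some m & vge v (D k l) m.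
  pose F ij := odflt 0 (v (D ij.1 ij.2)).
  have [ij hd hm] := @Order.TotalTheory.arg_minP _ _ _ (i0, j0)
    (fun ij => D ij.1 ij.2 != 0) F h0.
  exists ij; split=> // k l hkl; have [m em] := nval_neq0 hd; exists m => //.
  have [m' em'] := nval_neq0 hkl; rewrite (vge_nval _ em').
  by have := hm (k, l) hkl; rewrite /F em em'.
have vD k l : vge v (D k l / D i j) 0.
  have [->|hkl] := eqVneq (D k l) 0; first by rewrite mul0r vge_zero.
  have [m em hm] := hmin _ _ hkl.
  by apply: vgeM hm _ (_ : 0 <= m - m); rewrite ?(vge_nval _ (nvalV em)) ?subrr.
pose M := mat2 (x i 0 0) (x j 0 0) (x i 1 0) (x j 1 0).
have dM : \det M = D i j by rewrite det_mat2.
have hx k : mxge 0 (invmx M *m x k).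
  rewrite invmx_mat2 // scale_mat2 -/(D i j) => r s; rewrite ord1.
  case: (ord2P r) => ->.
    rewrite mulmx_col0 !mxE /=.
    rewrite (_ : _ + _ = D k j / D i j); first exact: vD.
    by rewrite [D k j]/D; ring.
  rewrite mulmx_col1 !mxE /=.
  rewrite (_ : _ + _ = D i k / D i j); first exact: vD.
  by rewrite [D i k]/D; ring.
exists M; split=> //; first by rewrite /isvert dM.
move=> g hg r s; pose k := if s == 0 then i else j.
have -> : conjm M g r s = (invmx M *m (g *m x k)) r 0.
  rewrite /conjm -mulmxA !mxE; apply: eq_bigr => q _; congr (_ * _).
  rewrite !mxE; apply: eq_bigr => t _; congr (_ * _); rewrite mxE /k.
  by case: (ord2P s) => ->; case: (ord2P t) => ->.
exact: hg.
Qed.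

Lemma gen_fixes_vertex (A B M : 'M[K]_2) : \det A = 1 -> \det B = 1 -> isvert M ->
  intmx v (conjm M A) -> intmx v (conjm M B) ->
  forall g, gen A B g -> intmx v (conjm M g).
Proof.
move=> hA hB hM iA iB g; elim=> {g} //.
- by rewrite conjm_scalar //; apply: intmx_scalar; rewrite vge1.
- by rewrite conjm_inv //; apply: intmx_inv; rewrite // det_conjm // hA nval1.
- by rewrite conjm_inv //; apply: intmx_inv; rewrite // det_conjm // hB nval1.
- by move=> g h _ ig _ ih; rewrite conjmM //; apply: intmxM.
Qed.

(* When the three traces are integral, O + OA + OB + OAB is an order, so the
   orbit of a vector under it spans a lattice stable under A and B. *)
Lemma common_vertex (A B : 'M[K]_2) : \det A = 1 -> \det B = 1 ->
  vge v (\tr A) 0 -> vge v (\tr B) 0 -> vge v (\tr (A *m B)) 0 ->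
  exists M, [/\ isvert M, intmx v (conjm M A) & intmx v (conjm M B)].
Proof.
move=> hA hB tA tB tAB.
pose ind (X : 'M[K]_2) (e : 'cV[K]_2) := e 0 0 * (X *m e) 1 0 - (X *m e) 0 0 * e 1 0.
(* A scalar of determinant 1 squares to 1, so it is a unit. *)
have scal X : \det X = 1 -> X = (X 0 0)%:M -> intmx v (conjm 1%:M X).
  move=> hX EX; have h2 : (X 0 0) ^+ 2 = 1 by move: hX; rewrite {1}EX det_scalar.
  rewrite EX conjm_scalar ?det1 ?oner_neq0 //; apply: intmx_scalar.
  have [m em] : exists m, v (X 0 0) = Some m.
    apply: nval_neq0; apply/eqP => h0; move/eqP: h2.
    by rewrite h0 expr0n eq_sym oner_eq0.
  by have := nvalX 2 em; rewrite h2 nval1 (vge_nval _ em) => -[]; lia.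
have fam X e : (X = A \/ X = B) -> ind X e != 0 ->
    exists M, [/\ isvert M, intmx v (conjm M A) & intmx v (conjm M B)].
  move=> hX he.
  pose x (i : 'I_4) : 'cV[K]_2 := nth 0 [:: e; A *m e; B *m e; A *m B *m e] i.
  have [j hj] : exists j, x j = X *m e.
    by case: hX => ->; [exists 1 | exists (inord 2)]; rewrite /x //= inordK.
  rewrite /ind -hj in he.
  have [M [hM xM gM]] := @lattice_of_family _ x 0 j he.
  have h0 := xM 0; have h1 := xM 1; have h2 := xM (inord 2); have h3 := xM (inord 3).
  rewrite /x /= ?inordK //= in h0 h1 h2 h3.
  have chA : A *m A = \tr A *: A - 1%:M by rewrite cayley_hamilton2 hA.
  have chB : B *m B = \tr B *: B - 1%:M by rewrite cayley_hamilton2 hB.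
  (* Polarised Cayley-Hamilton: it rewrites BA in terms of 1, A, B and AB with integral
     coefficients. *)
  have ba : B *m A = (\tr (A *m B) - \tr A * \tr B) *: 1%:M
      + \tr A *: B + \tr B *: A - A *m B.
    move: hA hB; rewrite (mat2_eta A) (mat2_eta B) !det_mat2 => hA' hB'.
    rewrite !mul_mat2 !tr_mat2 !scalar_mat2 !scale_mat2 opp_mat2 !add_mat2.
    by congr mat2; ring.
  have bab : B *m (A *m B) = \tr (A *m B) *: B - \tr A *: 1%:M + A.
    rewrite mulmxA ba !mulmxDl mulNmx -!scalemxAl -[A *m B *m B]mulmxA chB.
    rewrite mul1mx mulmxBr mulmx1 -scalemxAr !scalerBr scalerA scalerBl opprB.
    by apply/matrixP => r s; rewrite !mxE; ring.
  have L0 : mxge 0 (invmx M *m (1%:M *m e)) by rewrite mul1mx.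
  have LD (Y Z : 'M[K]_2) : mxge 0 (invmx M *m (Y *m e)) ->
      mxge 0 (invmx M *m (Z *m e)) -> mxge 0 (invmx M *m ((Y + Z) *m e)).
    by move=> *; rewrite mulmxDl mulmxDr; apply: mxgeD.
  have LZ (Y : 'M[K]_2) (c : K) : vge v c 0 -> mxge 0 (invmx M *m (Y *m e)) ->
      mxge 0 (invmx M *m ((c *: Y) *m e)).
    by move=> hc hY; rewrite -scalemxAl -scalemxAr; apply: (mxgeZ hc hY).
  have LN (Y : 'M[K]_2) : mxge 0 (invmx M *m (Y *m e)) ->
      mxge 0 (invmx M *m ((- Y) *m e)).
    by move=> hY; rewrite mulNmx mulmxN; apply: mxgeN.
  have tts : vge v (\tr (A *m B) - \tr A * \tr B) 0 by rewrite vgeB // vgeMl.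
  have aab : A *m (A *m B) = \tr A *: (A *m B) - B.
    by rewrite mulmxA chA mulmxBl mul1mx -scalemxAl.
  have stab (Y : 'M[K]_2) : (forall Z, Z \in [:: 1%:M; A; B; A *m B] ->
      mxge 0 (invmx M *m ((Y *m Z) *m e))) -> intmx v (conjm M Y).
    move=> hY; apply: gM => i; rewrite /x.
    case: i => [[|[|[|[|i]]]] hi] //=.
    - by have := hY 1%:M; rewrite mulmx1; apply; rewrite !inE eqxx ?orbT.
    - by rewrite (mulmxA Y); apply: hY; rewrite !inE eqxx ?orbT.
    - by rewrite (mulmxA Y); apply: hY; rewrite !inE eqxx ?orbT.
    - by rewrite (mulmxA Y); apply: hY; rewrite !inE eqxx ?orbT.
  exists M; split=> //; apply: stab => Z; rewrite !inE => /or4P[] /eqP ->.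
  - by rewrite mulmx1; apply: h1.
  - by rewrite chA; apply: (LD _ _ (LZ _ _ tA h1) (LN _ L0)).
  - exact: h3.
  - by rewrite aab; apply: (LD _ _ (LZ _ _ tA h3) (LN _ h2)).
  - by rewrite mulmx1; apply: h2.
  - by rewrite ba; apply: (LD _ _ (LD _ _ (LD _ _ (LZ _ _ tts L0) (LZ _ _ tA h2))
                                          (LZ _ _ tB h1)) (LN _ h3)).
  - by rewrite chB; apply: (LD _ _ (LZ _ _ tB h2) (LN _ L0)).
  - by rewrite bab; apply: (LD _ _ (LD _ _ (LZ _ _ tAB h2) (LN _ (LZ _ _ tA L0))) h1).
(* A cyclic vector of A or of B supplies the independent pair; if both matrices are scalar there is
   none, and the standard lattice serves. *)
have [hAs|hAs] := eqVneq A (A 0 0)%:M; last first.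
  by have [e0 he0] := nonscalar_vec hAs; apply: fam he0; left.
have [hBs|hBs] := eqVneq B (B 0 0)%:M; last first.
  by have [e0 he0] := nonscalar_vec hBs; apply: fam he0; right.
by exists 1%:M; split; rewrite /isvert ?det1 ?oner_neq0 //; apply: scal.
Qed.

End Valuation.

(** * Apartments, ends and hyperbolic elements *)
Section Tree.
Variables (K : fieldType) (v : K -> option int) (p : nat).
Hypothesis HK : nonarch_local_field v p.
Variable pi : K.
Hypothesis hpi : v pi = Some 1.
Implicit Types (M N g P : 'M[K]_2).

Lemma pi_neq0 : pi != 0.
Proof. exact: (neq0_nval HK hpi). Qed.

Lemma nval_piz (i : int) : v (pi ^ i) = Some i.
Proof.
case: i => n; first by rewrite -exprnP (nvalX HK n hpi) mul1r.
by rewrite NegzE -invr_expz (nvalV HK (nvalX HK n.+1 hpi)) mul1r.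
Qed.

Lemma piz_neq0 (i : int) : pi ^ i != 0.
Proof. exact: (neq0_nval HK (nval_piz i)). Qed.

(* The vertices of the apartment whose ends are the two columns of P. *)
Definition apt P (i : int) : 'M[K]_2 := P *m mat2 1 0 0 (pi ^ i).

Lemma det_diag_piz (i : int) : \det (mat2 1 0 0 (pi ^ i)) != 0.
Proof. by rewrite det_mat2 mul1r mul0r subr0 piz_neq0. Qed.

Lemma apt_vert P i : isvert P -> isvert (apt P i).
Proof. by move=> hP; rewrite /isvert det_mulmx mulf_neq0 // det_diag_piz. Qed.

Lemma conjm_apt P g i a b c d : isvert P -> conjm P g = mat2 a b c d ->
  conjm (apt P i) g = mat2 a (b * pi ^ i) (c * pi ^ (- i)) d.
Proof.
move=> hP e; rewrite conjm_comp ?det_diag_piz // e /conjm.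
rewrite invmx_mat2 ?mul1r ?mul0r ?subr0 ?piz_neq0 // scale_mat2 !mul_mat2.
have h := piz_neq0 i; rewrite -(invr_expz pi i).
by congr mat2; field.
Qed.

(** One formula for the relative position of g f(i) and x f(j): it serves adjacency and distances (g
    = 1), the fixed end of a triangular group, and the translation by B. *)
Lemma apt_rel P g i j (x a b c d : K) : isvert P -> \det g = 1 ->
  conjm P g = mat2 a b c d ->
  invmx (g *m apt P i) *m (x *: apt P j) =
  mat2 (x * d) (- x * b * pi ^ j) (- x * c * pi ^ (- i)) (x * a * pi ^ (j - i)).
Proof.
move=> hP hg e; have dg : \det g != 0 by rewrite hg oner_neq0.
rewrite invmx_mul // ?apt_vert // /apt invmx_mul ?det_diag_piz //.
have -> : invmx (mat2 1 0 0 (pi ^ i)) *m invmx P *m invmx g *m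
  (x *: (P *m mat2 1 0 0 (pi ^ j))) =
  x *: (invmx (mat2 1 0 0 (pi ^ i)) *m conjm P (invmx g) *m mat2 1 0 0 (pi ^ j)).
  by rewrite -scalemxAr /conjm !mulmxA.
have -> : conjm P (invmx g) = mat2 d (- b) (- c) a.
  rewrite conjm_inv // invmx_adj ?det_conjm // e tr_mat2 scalar_mat2 opp_mat2 add_mat2.
  by congr mat2; ring.
rewrite invmx_mat2 ?mul1r ?mul0r ?subr0 ?piz_neq0 // scale_mat2 !mul_mat2 scale_mat2.
rewrite (expfzDr _ _ pi_neq0) -(invr_expz pi i); have h := piz_neq0 i.
by congr mat2; field.
Qed.

Lemma conjm1 P : isvert P -> conjm P 1%:M = mat2 1 0 0 1.
Proof. by move=> hP; rewrite conjm_scalar // scalar_mat2. Qed.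

Lemma apt_rel1 P i j (x : K) : isvert P ->
  invmx (apt P i) *m (x *: apt P j) = mat2 x 0 0 (x * pi ^ (j - i)).
Proof.
move=> hP; rewrite -[apt P i]mul1mx (apt_rel _ _ _ hP (det1 _ _) (conjm1 hP)).
by rewrite !(mulr1, mulr0, mul0r).
Qed.

Lemma adj_aptS P i : isvert P -> adj v (apt P i) (apt P (i + 1)).
Proof.
move=> hP; exists 1; split; first exact: oner_neq0.
rewrite apt_rel1 // mul1r [_ - i]addrC addKr expr1z.
split; [|split].
- by apply/intmx_mat2; rewrite ?(vge1 HK) ?(vge_zero HK) // (vge_nval _ hpi).
- rewrite invmx_mat2 ?mul1r ?mul0r ?subr0 ?pi_neq0 // scale_mat2 => r s.
  rewrite mxE; do 2?case: ifP => _; rewrite ?oppr0 ?mulr0 ?(vge_zero HK) //.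
    by rewrite mulVf ?pi_neq0 // (vge1 HK).
  by rewrite mulr1 (vge_nval _ (nvalV HK hpi)).
- by rewrite det_mat2 mul1r mul0r subr0.
Qed.

Lemma adj_aptP P i : isvert P -> adj v (apt P (i + 1)) (apt P i).
Proof.
move=> hP; exists pi; split; first exact: pi_neq0.
have e : pi * pi ^ (i - (i + 1)) = 1.
  by rewrite opprD addrA subrr sub0r -invr_expz expr1z mulfV ?pi_neq0.
rewrite apt_rel1 // e.
split; [|split].
- by apply/intmx_mat2; rewrite ?(vge1 HK) ?(vge_zero HK) // (vge_nval _ hpi).
- rewrite invmx_mat2 ?mulr1 ?mul0r ?subr0 ?pi_neq0 // scale_mat2 => r s.
  rewrite mxE; do 2?case: ifP => _; rewrite ?oppr0 ?mulr0 ?(vge_zero HK) //.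
    by rewrite mulr1 (vge_nval _ (nvalV HK hpi)).
  by rewrite mulVf ?pi_neq0 // (vge1 HK).
- by rewrite det_mat2 mulr1 mul0r subr0.
Qed.

(** The matrices attached to successive edges multiply, each adding 1 to the valuation of the
    determinant. This bounds distances from below. *)
Lemma reach_rel M M' n : reach v M M' n -> exists c, [/\ c != 0,
  intmx v (invmx M *m (c *: M')) & v (\det (invmx M *m (c *: M'))) = Some n%:Z].
Proof.
case=> s [sv [s0 [sn sadj]]]; rewrite -s0 -sn {s0 sn}.
elim: n sadj => [|n IH] sadj.
  exists 1; rewrite oner_neq0 scale1r mulVmx ?unitmx_det; last exact: sv.
  by rewrite det1 (nval1 HK); split=> //; apply: (intmx_scalar HK); rewrite (vge1 HK).
have [c [c0 ic dc]] := IH (fun i hi => sadj i (ltnW hi)).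
have [c' [c0' [ic' [_ dc']]]] := sadj n (leqnn _).
exists (c * c'); have -> : invmx (s 0%N) *m ((c * c') *: s n.+1) =
   (invmx (s 0%N) *m (c *: s n)) *m (invmx (s n) *m (c' *: s n.+1)).
  rewrite -!scalemxAr -!scalemxAl scalerA mulmxA mulmxK ?unitmx_det; last exact: sv.
  by rewrite mulrC.
split; [by rewrite mulf_neq0 | exact: (intmxM HK) |].
by rewrite det_mulmx (nvalM HK dc dc') -addn1.
Qed.

Lemma geod_line_apt P : isvert P -> geod_line v (apt P).
Proof.
move=> hP; split=> [i|i j]; first exact: apt_vert.
split; last first.
  (* The relative position is diagonal with entries of valuations n >= 0 and n + (j - i) >= 0; their
     sum is m, which is therefore at least |i - j|. *)
  move=> m /reach_rel [c [c0]]; rewrite apt_rel1 // det_mat2 mul0r subr0.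
  have [n en] := nval_neq0 HK c0; have e1 := nvalM HK en (nval_piz (j - i)).
  move=> /intmx_mat2 [h1 _ _ h4]; move: h1 h4.
  by rewrite (vge_nval _ en) (vge_nval _ e1) (nvalM HK en e1) => h1 h2 [h3]; lia.
have up k (n : nat) : reach v (apt P k) (apt P (k + n%:Z)) n.
  exists (fun t => apt P (k + t%:Z)); split=> [t|]; first exact: apt_vert.
  rewrite addr0; do 2?split=> //; move=> t _.
  by rewrite -addn1 PoszD addrA; apply: adj_aptS.
have down k (n : nat) : reach v (apt P (k + n%:Z)) (apt P k) n.
  exists (fun t => apt P (k + n%:Z - t%:Z)); split=> [t|]; first exact: apt_vert.
  rewrite subr0 addrK; do 2?split=> //; move=> t _.
  have -> : k + n%:Z - t%:Z = k + n%:Z - t.+1%:Z + 1 by lia.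
  exact: adj_aptP.
case: (lerP i j) => h.
  have e : j = i + `|i - j|%N%:Z by lia.
  by rewrite {1}e; apply: up.
have e : i = j + `|i - j|%N%:Z by lia.
by rewrite {1}e; apply: down.
Qed.

Lemma gen_upper (A B : 'M[K]_2) P : \det A = 1 -> \det B = 1 -> isvert P ->
  conjm P A 1 0 = 0 -> conjm P B 1 0 = 0 ->
  forall g, gen A B g -> conjm P g 1 0 = 0.
Proof.
move=> hA hB hP eA eB g; elim=> {g} //.
- by rewrite conjm1 // mxE.
- by rewrite conjm_inv // invmx_10 ?det_conjm // eA oppr0.
- by rewrite conjm_inv // invmx_10 ?det_conjm // eB oppr0.
- move=> g h _ ig _ ih; rewrite conjmM //.
  rewrite (mat2_eta (conjm P g)) (mat2_eta (conjm P h)) mul_mat2 mxE /= ig ih.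
  by rewrite mul0r mulr0 addr0.
Qed.

(** As i grows, [apt P i] tends to the end given by the first column of P, which is a common
    eigenvector. Far enough along this ray the upper right entry of g becomes harmless and g acts as
    a shift by l - m. *)
Lemma elementary_upper (A B : 'M[K]_2) P : \det A = 1 -> \det B = 1 -> isvert P ->
  conjm P A 1 0 = 0 -> conjm P B 1 0 = 0 -> elementary v (gen A B).
Proof.
move=> hA hB hP eA eB; right; left.
have [gv gd] := geod_line_apt hP.
exists (fun n : nat => apt P n%:Z); split; first by split=> *; [exact: gv | exact: gd].
move=> g hg; have hu := gen_upper hA hB hP eA eB hg.
have dg := gen_det1 hA hB hg.
have eg := mat2_eta (conjm P g); rewrite hu in eg.
move: (conjm P g 0 0) (conjm P g 0 1) (conjm P g 1 1) eg => a b d eg.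
have : \det (conjm P g) = 1 by rewrite det_conjm.
rewrite eg det_mat2 mulr0 subr0 => had.
have a0 : a != 0 by apply/eqP => a0; move/eqP: had; rewrite a0 mul0r eq_sym oner_eq0.
have d0 : d != 0 by apply/eqP => d0; move/eqP: had; rewrite d0 mulr0 eq_sym oner_eq0.
have [m em] := nval_neq0 HK a0; have [l el] := nval_neq0 HK d0.
have hml : m + l = 0 by have := nvalM HK em el; rewrite had (nval1 HK) => -[].
have [k hk] : exists k : nat, vge v (a * b) (- k%:Z).
  case e : (v (a * b)) => [t|]; last by exists 0%N; rewrite /vge e.
  by exists `|t|%N; rewrite (vge_nval _ e); lia.
have shift (i j : int) : j - i = l - m -> k%:Z <= j ->
    lat_eq v (g *m apt P i) (apt P j).
  move=> hij hj; apply: (lat_eqI HK a0); rewrite (apt_rel _ _ _ hP dg eg) had.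
    have e1 := nvalM HK (nvalM HK em em) (nval_piz (j - i)).
    apply/intmx_mat2; rewrite (vge1 HK) mulr0 mul0r (vge_zero HK) (vge_nval _ e1).
    split=> //; last by lia.
    rewrite !mulNr (vgeN HK).
    apply: (vgeM HK) hk (_ : vge v (pi ^ j) j) _; last by lia.
    by rewrite (vge_nval _ (nval_piz j)).
  rewrite det_mat2 !(mulr0, mul1r, mul0r, subr0).
  rewrite (nvalM HK (nvalM HK em em) (nval_piz _)); congr Some; lia.
(* As l = - m, the shift is - 2m; starting at k + 2|m| keeps the target index at least k. *)
exists (k + `|m|.*2)%N, (absz ((k + `|m|.*2)%:Z + (l - m))) => i.
by apply: shift; lia.
Qed.

(* The root is the fixed point of the contraction x |-> (x^2 + 1) / s. *)
Lemma small_root s n : v s = Some (- n) -> 0 < n ->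
  exists x, x ^+ 2 - s * x + 1 = 0 /\ v x = Some n.
Proof.
move=> es n0; have s0 := neq0_nval HK es.
have et : v s^-1 = Some n by rewrite (nvalV HK es) opprK.
pose f (x : K) := s^-1 * (x ^+ 2 + 1).
pose u k := iter k f 0.
have ft x : vge v x 0 -> vge v (f x) 1.
  move=> hx; apply: (vgeM HK) (_ : vge v s^-1 n) (_ : vge v (x ^+ 2 + 1) 0) _.
  - by rewrite (vge_nval _ et).
  - by rewrite (vgeD HK) // ?(vgeXint HK) // (vge1 HK).
  - by lia.
have fc x y k : vge v x 0 -> vge v y 0 -> vge v (x - y) k -> vge v (f x - f y) (k + 1).
  move=> hx hy hk; have -> : f x - f y = s^-1 * ((x + y) * (x - y)) by rewrite /f; ring.
  apply: (vgeM HK) (_ : vge v s^-1 n) (vgeMl HK (vgeD HK hx hy) hk) _.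
    by rewrite (vge_nval _ et).
  by lia.
have u0 k : vge v (u k) 0.
  elim: k => [|k IH]; first exact: (vge_zero HK).
  exact: vge_le (ft _ IH).
have uS k : vge v (u k.+1 - u k) k%:Z.
  elim: k => [|k IH]; first by rewrite (vgeB HK).
  have -> : k.+1%:Z = k%:Z + 1 by lia.
  exact: (fc _ _ _ (u0 _) (u0 _) IH).
have uc k i : vge v (u (k + i)%N - u k) k%:Z.
  elim: i => [|i IH]; first by rewrite addn0 subrr (vge_zero HK).
  rewrite addnS.
  have -> : u (k + i).+1 - u k = (u (k + i).+1 - u (k + i)%N) + (u (k + i)%N - u k) by ring.
  apply: (vgeD HK) => //.
  by apply: vge_le (uS _); lia.
have [l hl] : exists l, forall k : int, exists N : nat, forall i, (N <= i)%N -> vge v (u i - l) k.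
  apply: (nlf_complete HK) => k; exists `|k|%N => i j hi hj.
  have -> : u i - u j = (u i - u `|k|%N) - (u j - u `|k|%N) by ring.
  apply: (vgeB HK).
    by rewrite -(subnKC hi); apply: vge_le (uc _ _); lia.
  by rewrite -(subnKC hj); apply: vge_le (uc _ _); lia.
have l1 : vge v l 1.
  have [N hN] := hl 1; have := hN N.+1 (leqnSn _) => h.
  have -> : l = u N.+1 - (u N.+1 - l) by ring.
  by apply: (vgeB HK) => //; apply: ft.
have fix_l : l - f l = 0.
  apply: (vge_zeroP HK) => k; have [N hN] := hl k%:Z.
  have -> : l - f l = (f (u N) - f l) - (u N.+1 - l) by rewrite /u /=; ring.
  apply: (vgeB HK); last exact: hN.
  by apply: vge_le (fc _ _ _ (u0 _) _ (hN N (leqnn _))); [lia | apply: vge_le l1].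
have lE : l = s^-1 * (1 + l ^+ 2).
  by move/eqP: fix_l; rewrite subr_eq0 => /eqP {1}->; rewrite /f addrC.
exists l; split.
  have -> : s * l = 1 + l ^+ 2 by rewrite {1}lE mulVKf.
  by ring.
rewrite lE; have e1 : v (1 + l ^+ 2) = Some 0.
  apply: (nval_dom HK) (nval1 HK) _; rewrite add0r.
  by apply: (vgeM HK l1 l1).
by rewrite (nvalM HK et e1) addr0.
Qed.

Lemma diagonalize_hyp (B : 'M[K]_2) : \det B = 1 -> ~~ vge v (\tr B) 0 ->
  exists P x (n : nat), [/\ isvert P, (0 < n)%N, v x = Some n%:Z &
    conjm P B = mat2 x^-1 0 0 x].
Proof.
move=> hB hs; have [m em lm] := nvge_nval hs.
have em' : v (\tr B) = Some (- (- m)) by rewrite opprK.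
have nm : 0 < - m by lia.
have [x [hx ex]] := small_root em' nm.
have x0 := neq0_nval HK ex.
(* A scalar matrix of determinant 1 has integral trace, so B has a cyclic vector e. *)
have ns : B != (B 0 0)%:M.
  apply/eqP => eB; move: hB; rewrite {1}eB det_scalar => h2.
  have [t et] : exists t, v (B 0 0) = Some t.
    apply: (nval_neq0 HK); apply/eqP => h0; move/eqP: h2.
    by rewrite h0 expr0n eq_sym oner_eq0.
  have := nvalX HK 2 et; rewrite h2 (nval1 HK) => -[] ht.
  move: hs; rewrite eB mxtrace_scalar mulr2n (vgeD HK) // (vge_nval _ et); lia.
have [e he] := nonscalar_vec ns.
pose y := x^-1; have xy : x * y = 1 by rewrite mulfV.
have sE : \tr B = x + y.
  apply: (mulIf x0); rewrite mulrDl mulVf //.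
  by apply/eqP; rewrite eq_sym -subr_eq0 -hx; apply/eqP; ring.
have xny : y - x != 0.
  apply/eqP => h; have := nvalV HK ex; have := hs.
  have -> : x^-1 = x by apply/eqP; rewrite -subr_eq0 -/y h.
  by rewrite ex => _ [] ?; lia.
pose f := B *m e.
(* The columns are (B - x) e and (B - y) e; by Cayley-Hamilton they are eigenvectors for y = x^-1
   and x respectively, and they are independent because e is cyclic and x differs from y. *)
pose P := mat2 (f 0 0 - x * e 0 0) (f 0 0 - y * e 0 0)
               (f 1 0 - x * e 1 0) (f 1 0 - y * e 1 0).
have dP : \det P != 0.
  rewrite det_mat2.
  have -> : (f 0 0 - x * e 0 0) * (f 1 0 - y * e 1 0) -
     (f 0 0 - y * e 0 0) * (f 1 0 - x * e 1 0) =
     (y - x) * (e 0 0 * f 1 0 - f 0 0 * e 1 0) by ring.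
  exact: mulf_neq0.
exists P, x, `|m|%N; split=> //; first by lia.
  by rewrite ex; congr Some; lia.
suff E : B *m P = P *m mat2 y 0 0 x.
  by rewrite /conjm -mulmxA E mulmxA mulVmx ?unitmx_det // mul1mx.
have [a [b [c [d eB]]]] : exists a b c d, B = mat2 a b c d.
  by exists (B 0 0), (B 0 1), (B 1 0), (B 1 1); apply: mat2_eta.
move: hB sE; rewrite /P /f mulmx_col0 mulmx_col1 eB det_mat2 tr_mat2 !mxE /= => hB' sE.
have ed : d = x + y - a by rewrite -sE; ring.
have ebc : b * c = a * (x + y - a) - x * y by rewrite xy -hB' ed; ring.
by rewrite ed !mul_mat2; congr mat2; ring: ebc.
Qed.

End Tree.

(** * Residually unipotent torsion *)
Section Torsion.
Variables (K : fieldType) (v : K -> option int) (p : nat).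
Hypothesis HK : nonarch_local_field v p.
Implicit Types (M N g X Y : 'M[K]_2).

Let p_prime : prime p := nlf_prime HK.

Lemma mxgeMn k X (n : nat) : mxge v k X -> mxge v k (X *+ n).
Proof.
move=> hX; rewrite -scaler_nat -[k]add0r; apply: (mxgeZ HK) => //; exact: (vge_nat HK).
Qed.

Lemma mxge_sum (I : Type) (r : seq I) (P : pred I) (F : I -> 'M[K]_2) k :
  (forall i, P i -> mxge v k (F i)) -> mxge v k (\sum_(i <- r | P i) F i).
Proof.
move=> h; apply: (big_ind (fun X => mxge v k X)) => // [i j|X Y hX hY].
  by rewrite mxE (vge_zero HK).
exact: (mxgeD HK).
Qed.

(** In the binomial expansion the linear term gains a level from the factor p, and all later terms
    gain it from N^2. *)
Lemma mxge_exprp_sub1 N k : 0 <= k -> mxge v k N -> mxge v (k + 1) (N * N) ->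
  mxge v (k + 1) ((N + 1) ^+ p - 1).
Proof.
move=> k0 hN hN2.
have N0 : intmx v N by apply: mxge_le hN.
have [q eq] : exists q, p = q.+2 by case: (p) p_prime => [|[|q]] // _; exists q.
have hp : vge v q.+2%:R 1 by rewrite -eq; exact: (nlf_res_char HK).
rewrite eq exprD1n big_ord_recl big_ord_recl expr0 bin0 mulr1n [1 + (_ + _)]addrC addrK.
apply: (mxgeD HK).
  rewrite expr1 -scaler_nat bin1 addrC; exact: (mxgeZ HK).
apply: mxge_sum => i _; apply: mxgeMn; rewrite /= !exprS mulrA.
apply: (mxgeM HK) hN2 (intmxX HK _ N0) _; lia.
Qed.

(** Supplies the gain on N^2 when N = X - 1 is merely integral: residual unipotence puts tr X - 2 in
    the maximal ideal. *)
Lemma sub1_sqr X : \det X = 1 -> (X - 1) * (X - 1) = (\tr X - 2%:R) *: X.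
Proof.
move=> hX; rewrite mulrBl mulrBr !mulr1 mul1r -mulmxE cayley_hamilton2 hX.
apply/matrixP => i j; rewrite !mxE; ring.
Qed.

Lemma det_sub1 X : \det X = 1 -> \det (X - 1) = 2%:R - \tr X.
Proof.
have [a [b [c [d ->]]]] : exists a b c d, X = mat2 a b c d.
  by exists (X 0 0), (X 0 1), (X 1 0), (X 1 1); apply: mat2_eta.
have -> : mat2 a b c d - 1 = mat2 (a - 1) b c (d - 1).
  by rewrite [1]scalar_mat2 opp_mat2 add_mat2 !subr0.
rewrite !det_mat2 tr_mat2 => h.
have -> : (a - 1) * (d - 1) - b * c = (a * d - b * c) - a - d + 1 by ring.
by rewrite h; ring.
Qed.

(* Residually unipotent: the characteristic polynomial of the reduction of g
   is (X - 1)^2. *)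
Definition runip g :=
  [/\ \det g = 1, vge v (\tr g - 2%:R) 1 & exists M, isvert M /\ intmx v (conjm M g)].

Lemma det1X g n : \det g = 1 -> \det (g ^+ n) = 1.
Proof.
move=> hg; elim: n => [|n IH]; first by rewrite expr0 det1.
by rewrite exprS -mulmxE det1_mul.
Qed.

Lemma runipX g n : runip g -> runip (g ^+ n).
Proof.
move=> [hg tg [M [hM iM]]]; split; first exact: det1X.
  (* 2 - tr(g^n) is det(g^n - 1), a multiple of det(g - 1) by the determinant of an integral
     geometric sum. *)
  rewrite -(vgeN HK) opprB -det_sub1 ?det1X // subrX1 -mulmxE det_mulmx.
  apply: (vgeMr HK); first by rewrite det_sub1 // -opprB (vgeN HK).
  rewrite -(det_conjm _ hM); apply: (intmx_det HK).
  suff : forall m, intmx v (conjm M (\sum_(i < m) g ^+ i)) by apply.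
  elim=> [|m IH]; first by rewrite big_ord0 /conjm mulmx0 mul0mx => i j; rewrite mxE (vge_zero HK).
  rewrite big_ord_recr conjmD; apply: (mxgeD HK) => //=.
  by rewrite conjmX //; apply: (intmxX HK).
by exists M; split=> //; rewrite conjmX //; apply: (intmxX HK).
Qed.

Lemma runip_expn_sub1 g M (j : nat) : runip g -> isvert M -> intmx v (conjm M g) ->
  mxge v j%:Z (conjm M g ^+ (p ^ j) - 1).
Proof.
move=> [hg tg _] hM iM; set X := conjm M g in iM *.
have hX : \det X = 1 by rewrite det_conjm.
have i1 : intmx v (1 : 'M[K]_2) by apply: (intmx_scalar HK); rewrite (vge1 HK).
elim: j => [|[|j] IH].
- by rewrite expn0 expr1; apply: (mxgeB HK).
(* The first p-th power relies on [sub1_sqr]; from level 1 on, squaring raises the level by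
   itself. *)
- rewrite expn1 -{1}[X](subrK 1); apply: (@mxge_exprp_sub1 _ 0); rewrite ?sub1_sqr //.
  rewrite add0r -[1]addr0; apply: (mxgeZ HK) => //.
  by rewrite tr_conjm.
- rewrite expnSr exprM -{1}[X ^+ _](subrK 1).
  have -> : j.+2%:Z = j.+1%:Z + 1 by lia.
  apply: mxge_exprp_sub1 => //; apply: (mxgeM HK IH IH); lia.
Qed.

Section Discrete.
Variables (A B : 'M[K]_2).
Hypotheses (hA : \det A = 1) (hB : \det B = 1) (Hdisc : discrete v (gen A B)).

Lemma genX g n : gen A B g -> gen A B (g ^+ n).
Proof.
move=> hg; elim: n => [|n IH]; first exact: gen1.
by rewrite exprS; apply: genM.
Qed.

Lemma runip_torsion g : gen A B g -> runip g -> exists j, g ^+ (p ^ j) = 1.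
Proof.
move=> gg rg; have [_ _ [M [hM iM]]] := rg.
have [n hn] := Hdisc (gen1 A B).
have [a ha] := mxge_bound v M; have [b hb] := mxge_bound v (invmx M).
(* Conjugating back by M costs at most a + b levels, which leaves the n that discreteness at 1 asks
   for. *)
exists (`|n| + a + b)%N; apply: hn; first exact: genX.
set q := (p ^ _)%N.
have -> : g ^+ q = 1 + M *m (conjm M g ^+ q - 1) *m invmx M.
  rewrite mulmxBr mulmxBl mulmx1 mulmxV ?unitmx_det // -conjmX // conjmVK //.
  by rewrite addrC subrK.
move=> i j; rewrite [in X in vge v X _]mxE [_ + _ - _]addrC addKr; move: i j.
have hj := runip_expn_sub1 (`|n| + a + b) rg hM iM.
have h1 := mxgeM HK ha hj (lexx _).
apply: (mxgeM HK h1 hb); lia.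
Qed.

Lemma exists_order_p g : (exists j, g ^+ (p ^ j) = 1) -> g != 1 ->
  exists j, [/\ g ^+ (p ^ j) != 1, g ^+ (p ^ j) ^+ p = 1 & g ^+ (p ^ j.+1) = 1].
Proof.
move=> h g1; have h' : exists j, g ^+ (p ^ j) == 1 by have [j /eqP] := h; exists j.
case: (ex_minnP h') => [[|j]] /eqP e hmin.
  by move: e g1; rewrite expn0 expr1 => ->; rewrite eqxx.
exists j; rewrite -exprM -expnSr; split=> //.
by apply/negP => /hmin; rewrite ltnn.
Qed.

Lemma runip_trivial g :
  ~ (exists g, gen A B g /\ g ^+ p = 1%:M /\ g != 1%:M) ->
  gen A B g -> runip g -> g = 1.
Proof.
move=> np gg rg; apply/eqP; apply/negPn/negP => g1.
have [j [h1 h2 _]] := exists_order_p (runip_torsion gg rg) g1.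
by apply: np; exists (g ^+ (p ^ j)); split=> //; apply: genX.
Qed.

(** The powers of X have finitely many reductions modulo the maximal ideal, so two of them agree
    there. *)
Lemma residue_pigeonhole X : intmx v X -> \det X = 1 ->
  exists n, (0 < n)%N /\ mxge v 1 (X ^+ n - 1).
Proof.
move=> iX hX; have [s [s0 hs]] := nlf_residue_finite HK.
(* The index of the first representative of x; the extra value, reached when [find] fails, never
   occurs for integral x. *)
pose r (x : K) : 'I_(size s).+1 := inord (find (fun y => vge v (x - y) 1) s).
have rP x y : vge v x 0 -> vge v y 0 -> r x = r y -> vge v (x - y) 1.
  move=> hx hy e.
  have hhas z : vge v z 0 -> has (fun y => vge v (z - y) 1) s.
    by move=> /hs [w hw h]; apply/hasP; exists w.
  have hsz z : vge v z 0 -> (find (fun y => vge v (z - y) 1) s < size s)%N.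
    by move=> hz; rewrite -has_find hhas.
  have nx := nth_find 0 (hhas _ hx); have ny := nth_find 0 (hhas _ hy).
  have e' := congr1 val e; rewrite /r /= !inordK ?ltnS ?find_size // in e'.
  rewrite /= e' in nx; have -> : x - y = (x - s`_(find (fun z => vge v (y - z) 1) s))
      - (y - s`_(find (fun z => vge v (y - z) 1) s)) by ring.
  exact: (vgeB HK).
pose T := {ffun 'I_2 * 'I_2 -> 'I_(size s).+1}.
pose F (i : 'I_#|T|.+1) : T := [ffun ab => r ((X ^+ i) ab.1 ab.2)].
have /injectivePn [i [j ij eF]] : ~~ injectiveb F.
  apply/negP => /injectiveP /leq_card; by rewrite card_ord ltnn.
wlog lij : i j ij eF / (i < j)%N.
  move=> H; case: (ltngtP i j) => h; [exact: H eF h | | by move: ij; rewrite (val_inj h) eqxx].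
  by apply: (H j i); rewrite // eq_sym.
exists (j - i)%N; rewrite subn_gt0; split=> //.
have iXn n : intmx v (X ^+ n) by apply: (intmxX HK).
have hd : mxge v 1 (X ^+ j - X ^+ i).
  move=> a b; rewrite mxE [in X in _ + X]mxE; apply: rP; [exact: iXn | exact: iXn |].
  by have /ffunP /(_ (a, b)) := esym eF; rewrite !ffunE.
have u : X ^+ i \in unitmx by rewrite unitmx_det det1X // oner_neq0.
have -> : X ^+ (j - i) - 1 = invmx (X ^+ i) *m (X ^+ j - X ^+ i).
  have -> : X ^+ j = X ^+ i *m X ^+ (j - i) by rewrite mulmxE -exprD subnKC // ltnW.
  by rewrite mulmxBr mulKmx // mulVmx.
apply: (mxgeM HK) (_ : mxge v 0 _) hd _; last by rewrite add0r.
by apply: (intmx_inv HK); rewrite // det1X // (nval1 HK).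
Qed.

Lemma integral_conj g : \det g = 1 -> vge v (\tr g) 0 ->
  exists M, isvert M /\ intmx v (conjm M g).
Proof.
move=> hg tg; have t1 : vge v (\tr (1%:M : 'M[K]_2)) 0.
  by rewrite mxtrace1 (vge_nat HK).
have [|M [hM iM _]] := common_vertex HK hg (det1 _ _) tg t1; first by rewrite mulmx1.
by exists M.
Qed.

(** An integral trace makes g conjugate to an integral matrix; a power is trivial modulo the maximal
    ideal, hence residually unipotent, hence torsion. *)
Lemma finite_order g : gen A B g -> vge v (\tr g) 0 -> exists n, (0 < n)%N /\ g ^+ n = 1%:M.
Proof.
move=> gg tg; have hg := gen_det1 hA hB gg.
have [M [hM iM]] := integral_conj hg tg.
have [n [n0 hn]] := residue_pigeonhole iM (etrans (det_conjm g hM) hg).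
have rg : runip (g ^+ n).
  split; first exact: det1X.
    rewrite -(tr_conjm _ hM) conjmX //.
    have -> : (2%:R : K) = \tr (1 : 'M[K]_2) by rewrite mxtrace1.
    rewrite -raddfB [X in vge v X _](_ : _ = \sum_i (conjm M g ^+ n - 1) i i) //.
    apply: (big_ind (fun x => vge v x 1)) => [|x y|i _].
    - exact: (vge_zero HK).
    - exact: (vgeD HK).
    - exact: hn.
  by exists M; split=> //; rewrite conjmX //; apply: (intmxX HK).
have [j hj] := runip_torsion (genX n gg) rg.
exists (n * p ^ j)%N; rewrite muln_gt0 n0 expn_gt0 prime_gt0 // exprM hj.
by split.
Qed.

End Discrete.
End Torsion.

(** * Torsion over Q_p *)
Section Qp.
Variables (K : fieldType) (v : K -> option int) (p : nat).
Hypothesis HK : nonarch_local_field v p.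
Hypothesis HQp : is_Qp v.
Implicit Types (M N g X Y : 'M[K]_2).

Let p_prime : prime p := nlf_prime HK.

Lemma natr_neq0 (n : nat) : (0 < n)%N -> n%:R != 0 :> K.
Proof. by case: n => // n _; case: HQp => + _; apply. Qed.

Lemma nval_coprime (m : nat) : coprime p m -> v m%:R = Some 0.
Proof.
move=> cpm; apply: vge_unit_nval; first exact: (vge_nat HK).
apply/negP => hm.
have p0 := prime_gt0 p_prime.
have [a b e _] := egcdnP m p0.
have : vge v (1 : K) 1; last by rewrite (vge1 HK).
have -> : (1 : K) = p%:R * a%:R - b%:R * m%:R.
  by rewrite -!natrM mulnC e (eqP cpm) natrD [_ + 1%:R]addrC addrK.
apply: (vgeB HK); [apply: (vgeMr HK) | apply: (vgeMl HK)] => //;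
  by rewrite ?(vge_nat HK) // (nlf_res_char HK).
Qed.

Lemma sqr_intr (z : int) : (z%:~R : K) ^+ 2 = `|z|%N%:R ^+ 2.
Proof. by case: z => n //; rewrite NegzE rmorphN sqrrN abszN. Qed.

(** Stated for squares so that the sign of the numerator disappears and only natural numbers
    remain. *)
Lemma ratr_sqr (q : rat) : q != 0 -> exists (z : int) (m m' : nat),
  [/\ coprime p m, coprime p m' &
      (ratr q : K) ^+ 2 = (p%:R ^ z * (m%:R / m'%:R)) ^+ 2].
Proof.
move=> q0; have n0 : (0 < `|numq q|)%N by rewrite absz_gt0 numq_eq0.
have d0 : (0 < `|denq q|)%N by rewrite absz_gt0 denq_eq0.
have [m cm em] := pfactor_coprime p_prime n0.
have [m' cm' em'] := pfactor_coprime p_prime d0.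
move: em em'; set l := logn p _; set l' := logn p _ => em em'.
exists (l%:Z - l'%:Z), m, m'; split=> //.
have p0 : p%:R != 0 :> K by rewrite natr_neq0 // prime_gt0.
rewrite /ratr expr_div_n !sqr_intr -expr_div_n em em' !natrM !natrX.
rewrite expfzDr // -!exprnN -exprnP.
by congr (_ ^+ 2); rewrite invfM; ring.
Qed.

Lemma ratr_approx x n : v x = Some n -> exists q : rat,
  [/\ q != 0, v (ratr q) = Some n & vge v (x - ratr q) (n + 1)].
Proof.
move=> ex; have [_ /(_ x (n + 1)) [q hq]] := HQp.
have e : v (ratr q) = Some n.
  have -> : ratr q = x + - (x - ratr q) by rewrite opprB addrC subrK.
  by apply: (nval_dom HK ex); rewrite (vgeN HK).
exists q; split=> //; apply/eqP => q0.
by move: e; rewrite q0 /ratr (_ : numq 0 = 0) // mul0r (nval0 HK).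
Qed.

(** The residue characteristic only gives v p >= 1. A rational number close to a uniformiser has
    valuation 1, and this is a multiple of v p. *)
Lemma Qp_nval_p : v p%:R = Some 1.
Proof.
have [x ex] := nlf_surj HK 1.
have [q [q0 eq _]] := ratr_approx ex.
have [z [m [m' [cm cm' e]]]] := ratr_sqr q0.
have p0 : p%:R != 0 :> K by rewrite natr_neq0 // prime_gt0.
have [e1 ee1] := nval_neq0 HK p0.
have e1p : 1 <= e1 by rewrite -(vge_nval _ ee1) (nlf_res_char HK).
have vz : v (p%:R ^ z) = Some (e1 * z).
  case: z {e} => k; first exact: (nvalX HK).
  by rewrite NegzE -invr_expz -exprnP (nvalV HK (nvalX HK _ ee1)) mulrN.
have vm := nvalM HK vz (nvalM HK (nval_coprime cm) (nvalV HK (nval_coprime cm'))).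
have := nvalX HK 2 eq; rewrite e (nvalX HK 2 vm) => -[] h.
rewrite ee1; congr Some.
have h1 : e1 * z = 1 by lia.
have z1 : 1 <= z by nia.
have h2 : e1 - 1 <= (e1 - 1) * z by rewrite ler_peMr //; lia.
by lia.
Qed.

(** By density of Q it is enough to treat integers prime to p, and for p <= 3 these square to 1
    modulo p. *)
Lemma Qp_unit_sqr x : (p <= 3)%N -> v x = Some 0 -> vge v (x ^+ 2 - 1) 1.
Proof.
move=> p3 ex; have [q [q0 eq hq]] := ratr_approx ex.
have [z [m [m' [cm cm' e]]]] := ratr_sqr q0.
have z0 : z = 0.
  have vz : v (p%:R ^ z) = Some z.
    case: z {e} => k; first by rewrite -exprnP (nvalX HK _ Qp_nval_p) mul1r.
    by rewrite NegzE -invr_expz -exprnP (nvalV HK (nvalX HK _ Qp_nval_p)) mul1r.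
  have vm := nvalM HK vz (nvalM HK (nval_coprime cm) (nvalV HK (nval_coprime cm'))).
  by have := nvalX HK 2 eq; rewrite e (nvalX HK 2 vm) => -[]; lia.
have -> : x ^+ 2 - 1 = (x - ratr q) * (x + ratr q) + (ratr q ^+ 2 - 1) by ring.
apply: (vgeD HK).
  apply: (vgeMr HK hq); apply: (vgeD HK); rewrite ?(vge_nval _ ex) //.
  by rewrite (vge_nval _ eq).
have sq (k : nat) : coprime p k -> vge v ((k%:R : K) ^+ 2 - 1) 1.
  move=> ck; have k0 : (0 < k)%N.
    by case: k ck => //; rewrite /coprime gcdn0 => /eqP h; move: p_prime; rewrite h.
  have [w hw] : exists w, (k ^ 2 = w * p + 1)%N.
    have hk : (k ^ 2 %% p = 1)%N.
      have : (k %% p)%N != 0%N by rewrite -/(p %| k)%N -prime_coprime.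
      rewrite -modnXm; have := ltn_pmod k (prime_gt0 p_prime).
      have := prime_gt1 p_prime; move: p3; case: (p) => [|[|[|[|]]]] //= _ _;
      by case: (k %% _)%N => [|[|[|]]].
    by exists (k ^ 2 %/ p)%N; rewrite {1}(divn_eq (k ^ 2) p) hk.
  rewrite -natrX hw natrD addrK natrM.
  by apply: (vgeMl HK) (vge_nat HK _) (nlf_res_char HK).
rewrite e z0 expr0z mul1r.
have m'0 := neq0_nval HK (nval_coprime cm').
have -> : (m%:R / m'%:R) ^+ 2 - 1 =
  m'%:R ^- 2 * ((m%:R ^+ 2 - 1) - (m'%:R ^+ 2 - 1)) :> K by field.
apply: (vgeMl HK); last by apply: (vgeB HK); apply: sq.
by rewrite (vge_nval _ (nvalV HK (nvalX HK 2 (nval_coprime cm')))).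
Qed.

(** With N = g - 1, the matrix T below is the p-th cyclotomic polynomial at 1 + N, which is
    Eisenstein in N. It vanishes at N, although N satisfies a quadratic equation; only p = 2 and p =
    3 leave room for this. *)
Lemma Qp_order_p g : runip v g -> g ^+ p = 1 -> g != 1 ->
  (p = 2%N /\ g = -1) \/ (p = 3%N /\ \tr g = -1).
Proof.
move=> [hg tg _] gp g1.
pose N := g - 1; pose eps := \tr g - 2%:R.
have gN : g = N + 1 by rewrite subrK.
have N2 : N * N = eps *: g by rewrite /N sub1_sqr.
have [q eq] : exists q, p = q.+2 by case: (p) p_prime => [|[|q]] // _; exists q.
pose T := \sum_(i < p) N ^+ i *+ 'C(p, i.+1).
have NT : N * T = 0.
  have e : (N + 1) ^+ p = 1 + N * T.
    rewrite exprD1n big_ord_recl expr0 bin0 mulr1n /T mulr_sumr; congr (_ + _).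
    by apply: eq_bigr => i _; rewrite /= exprS -mulrnAr.
  by move/eqP: e; rewrite -gN gp -subr_eq0 opprD addrA subrr add0r oppr_eq0 => /eqP.
have p0 : p%:R != 0 :> K by rewrite natr_neq0 // prime_gt0.
(* If tr g = 2 then N^2 = 0 and N T = p N, so characteristic 0 would give g = 1. *)
have eps0 : eps != 0.
  apply/eqP => e0; rewrite e0 scale0r in N2.
  have ET : N * T = p%:R *: N.
    rewrite /T eq big_ord_recl expr0 bin1 mulrDr -[1 *+ _]scaler_nat -scalerAr mulr1.
    rewrite mulr_sumr big1 ?addr0 // => i _.
    by rewrite mulrnAr /= exprS mulrA N2 mul0r mul0rn.
  move/eqP: NT; rewrite ET scaler_eq0 (negbTE p0) /= subr_eq0 => /eqP e1.
  by rewrite e1 eqxx in g1.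
have T0 : T = 0.
  have u : N \in unitmx.
    by rewrite unitmx_det det_sub1 // -opprB oppr_eq0.
  by rewrite -[T](mulKmx u) [N *m T]NT mulmx0.
have gg : g * g = \tr g *: g - 1 by rewrite -mulmxE cayley_hamilton2 hg.
have [q2|q2] := ltnP q 2.
  case: q eq q2 => [|[|]] // eq _.
    left; split=> //; move: T0.
    rewrite /T eq !big_ord_recl big_ord0 /= expr0 expr1 addr0 /N => h.
    apply/eqP; rewrite -subr_eq0 opprK -h; apply/eqP.
    by apply/matrixP => i j; rewrite !mxE; ring.
  right; split=> //; move: T0.
  rewrite /T eq !big_ord_recl big_ord0 /= expr0 expr1 addr0 => h.
  have e : (1 + \tr g) *: g = 0.
    rewrite -h /N [_ ^+ _]sub1_sqr //; apply/matrixP => i j; rewrite !mxE; ring.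
  have gn0 : g != 0 by apply/eqP => g0; move: hg => /eqP; rewrite g0 det0 eq_sym oner_eq0.
  move/eqP: e; rewrite scaler_eq0 (negbTE gn0) orbF addrC => /eqP e.
  by apply/eqP; rewrite -subr_eq0 opprK e.
have eps1 : vge v eps 1 by [].
have detN : \det N = - eps by rewrite det_sub1 // -opprB.
clearbody N eps.
(* J is the maximal ideal of O[N]; for p >= 5 every binomial term beyond the
   constant one lies in p J, so T = p (1 + J), which is impossible. *)
pose J (Y : 'M[K]_2) := exists x y, [/\ vge v x 1, vge v y 0 & Y = x%:M + y *: N].
have NN : N * N = eps%:M + eps *: N.
  by rewrite N2 gN scalerDr addrC scalemx1.
have JD Y Z : J Y -> J Z -> J (Y + Z).
  move=> [x [y [hx hy ->]]] [z [w [hz hw ->]]].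
  exists (x + z), (y + w); split; [exact: (vgeD HK) | exact: (vgeD HK) |].
  by rewrite addrACA -scalerDl -(raddfD (@scalar_mx K 2)).
have JZ Y c : vge v c 0 -> J Y -> J (c *: Y).
  move=> hc [x [y [hx hy ->]]]; exists (c * x), (c * y).
  split; [exact: (vgeMl HK) | exact: (vgeMl HK) |].
  by rewrite scalerDr scalerA -scale_scalar_mx.
have JN k : J (N ^+ k.+1).
  elim: k => [|k [x [y [hx hy e]]]].
    exists 0, 1; rewrite (vge_zero HK) (vge1 HK) scale1r expr1; split=> //.
    by rewrite -scalemx1 scale0r add0r.
  exists (y * eps), (x + y * eps); split; first exact: (vgeMl HK).
    by apply: (vgeD HK); [apply: vge_le hx | apply: (vgeMl HK) => //; apply: vge_le eps1].
  rewrite exprSr e mulrDl -mulmxE mul_scalar_mx -scalemxAl mulmxE NN.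
  by rewrite scalerDr scalerA scale_scalar_mx scalerDl addrCA.
have J0 : J 0.
  by exists 0, 0; rewrite !(vge_zero HK) -scalemx1 !scale0r addr0.
have [Y [JY TE]] : exists Y, J Y /\ T = p%:R *: (1 + Y).
  pose ce := eps / p%:R.
  (* The top term N^(q+1) of T equals eps (N^(q-1) + N^q). As v p = 1, eps is divisible by p, and q
     >= 2 puts both powers in J. *)
  have hce : vge v ce 0.
    by apply: (vgeM HK eps1) (_ : vge v _ (-1)) _ => //; rewrite (vge_nval _ (nvalV HK Qp_nval_p)).
  pose Y1 := \sum_(i < q) ('C(p, i.+2) %/ p)%:R *: N ^+ i.+1.
  pose Y2 := ce *: (N ^+ q.-1 + N ^+ q).
  exists (Y1 + Y2); split.
    apply: (JD); last by apply: (JZ) => //; apply: (JD); case: (q) q2 => [|[|k]] //= _; apply: (JN).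
    rewrite /Y1; apply: (big_ind J) => // i _; apply: (JZ) => //; exact: (vge_nat HK).
  rewrite /T eq big_ord_recl big_ord_recr /= expr0 bin1 -eq.
  rewrite !scalerDr; congr (_ + (_ + _)).
  - by rewrite scaler_nat.
  - rewrite /Y1 scaler_sumr; apply: eq_bigr => i _; rewrite /bump /= add1n.
    have dv : (p %| 'C(p, i.+2))%N by apply: prime_dvd_bin => //; rewrite eq !ltnS /=.
    by rewrite scalerA -natrM mulnC divnK // scaler_nat.
  - rewrite /Y2 /ce /bump /= !add1n binn mulr1n scalerA [p%:R * _]mulrC divfK //.
    case: (q) q2 => [|k] // _; rewrite [in LHS]exprS [in LHS]exprS mulrA N2 /= -scalerAl.
    by congr (_ *: _); rewrite gN mulrDl mul1r -exprS addrC.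
(* 1 + Y = 0 makes y N the scalar - (1 + x), whose determinant is a unit, whereas det(y N) = - y^2
   eps lies in the maximal ideal. *)
exfalso; move/eqP: T0; rewrite TE scaler_eq0 (negbTE p0) /= addr_eq0 => /eqP e1.
have [x [y [hx hy eY]]] := JY.
have yN : y *: N = (- (1 + x))%:M.
  rewrite raddfN raddfD /= opprD [1%:M]e1 eY.
  by rewrite opprK addrAC subrr add0r.
have := congr1 (fun X => v (\det X)) yN.
rewrite /= detZ detN det_scalar sqrrN.
have v1x : v (1 + x) = Some 0 by apply: (nval_dom HK (nval1 HK)).
rewrite (nvalX HK 2 v1x) => e2.
have : vge v (y ^+ 2 * - eps) 1.
  by apply: (vgeMl HK); [apply: (vgeXint HK) | rewrite (vgeN HK)].
by rewrite (vge_nval _ e2).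
Qed.
End Qp.

(** * Trace identities and exceptional torsion *)
Section TwoGenerators.
Variables (K : fieldType) (v : K -> option int) (p : nat).
Hypothesis HK : nonarch_local_field v p.
Variables (A B : 'M[K]_2).
Hypotheses (hA : \det A = 1) (hB : \det B = 1) (Hdisc : discrete v (gen A B)).
Implicit Types (M N g X Y P : 'M[K]_2).

Lemma tr_sqr g : \det g = 1 -> \tr (g ^+ 2) = \tr g ^+ 2 - 2%:R.
Proof.
move=> hg; rewrite expr2 -mulmxE cayley_hamilton2 hg linearB linearZ /= mxtrace1.
by rewrite expr2.
Qed.

Lemma tr_cube g : \det g = 1 -> \tr (g ^+ 3) = \tr g ^+ 3 - 3%:R * \tr g.
Proof.
move=> hg; have gg : g * g = \tr g *: g - 1 by rewrite -mulmxE cayley_hamilton2 hg.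
have -> : g ^+ 3 = (\tr g ^+ 2 - 1) *: g - (\tr g)%:M.
  rewrite !exprS expr0 mulr1 gg mulrBr mulr1 -scalerAr gg.
  by apply/matrixP => i j; rewrite !mxE; case: (i == j); rewrite ?mulr1n ?mulr0n; ring.
by rewrite linearB linearZ /= mxtrace_scalar; ring.
Qed.

Lemma sqr_integral (x : K) : vge v (x ^+ 2) 0 -> vge v x 0.
Proof.
move=> h; apply: (vge_monic2 HK (b := 0) (c := 0)); rewrite ?(vge_zero HK) //.
by rewrite mul0r subr0 addr0.
Qed.

Lemma tr_integral (x : K) : vge v (x ^+ 2 - 4%:R) 0 -> vge v x 0.
Proof.
by move=> h; apply: sqr_integral; rewrite -[x ^+ 2](subrK 4%:R) (vgeD HK) // (vge_nat HK).
Qed.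

(** The square is needed because a small t^2 - 4 determines the trace only up to sign in the residue
    field. *)
Lemma runip_sqr g : \det g = 1 -> vge v (\tr g ^+ 2 - 4%:R) 1 -> runip v (g ^+ 2).
Proof.
move=> hg h; split; first exact: det1X.
  by rewrite tr_sqr //; have -> : \tr g ^+ 2 - 2%:R - 2%:R = \tr g ^+ 2 - 4%:R by ring.
have tg : vge v (\tr g) 0 by apply: tr_integral; apply: vge_le h.
have [M [hM iM]] := integral_conj HK hg tg.
by exists M; split=> //; rewrite conjmX //; apply: (intmxX HK).
Qed.

Lemma tr_sqrtN1 g : \det g = 1 -> g ^+ 2 = -1 -> \tr g = 0.
Proof.
move=> hg; rewrite expr2 -mulmxE cayley_hamilton2 hg => /eqP.
rewrite -subr_eq0 opprK subrK scaler_eq0 => /orP[/eqP // | /eqP g0].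
by move/eqP: hg; rewrite g0 det0 eq_sym oner_eq0.
Qed.

(* In Q_p the only infinitesimally unipotent torsion comes from Z_2[i] and
   Z_3[zeta_3]. *)
Lemma Qp_exceptional g : is_Qp v -> gen A B g -> vge v (\tr g ^+ 2 - 4%:R) 1 ->
  g ^+ 2 != 1 -> (p = 2%N /\ \tr g = 0) \/ (p = 3%N /\ \tr g ^+ 2 = 1).
Proof.
move=> HQp gg h g2; have hg := gen_det1 hA hB gg.
have r2 := runip_sqr hg h.
have g2g : gen A B (g ^+ 2) by apply: genX.
have [j [h1 h2 h3]] := exists_order_p (runip_torsion HK Hdisc g2g r2) g2.
have vp := Qp_nval_p HK HQp.
case: (Qp_order_p HK HQp (runipX HK _ r2) h2 h1) => [[p2 e]|[p3 e]].
  left; split=> //; rewrite p2 -exprM mulnC exprM in e.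
  have e1 := tr_sqrtN1 (det1X _ hg) e.
  (* For positive j the previous power of g would have a trace whose square is 2, of valuation 1 in
     Q_2. *)
  case: j e e1 {h1 h2 h3} => [|j] _; first by rewrite expn0 expr1.
  rewrite expnSr exprM tr_sqr ?det1X // => /eqP; rewrite subr_eq0 => /eqP e2.
  by rewrite p2 in vp; case: (nval_neq_odd HK (k := 0) _ e2).
right; split=> //; case: j e {h1 h2 h3} => [|j].
  rewrite expn0 expr1 tr_sqr // => /eqP; rewrite subr_eq => /eqP ->; ring.
rewrite p3 expnSr exprM tr_cube; last by rewrite !det1X.
have [_ + _] := runipX HK (3 ^ j) r2; set y := \tr _ - 2%:R => hy e.
have tE : \tr (g ^+ 2 ^+ (3 ^ j)) = y + 2%:R by rewrite subrK.
(* For positive j, the trace 2 + y of g^(2 3^(j-1)) would give y^3 + 6 y^2 + 9 y + 3 = 0 with y in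
   the maximal ideal; all terms but 3 then have valuation at least 2. *)
have e3 : 3%:R = - (3%:R * (3%:R * y) + y * (3%:R * (2%:R * y) + y * y)).
  rewrite tE in e; apply/eqP; rewrite -subr_eq0 -(addNr 1) -e; apply/eqP; ring.
rewrite p3 in vp; have v3 : vge v (3%:R : K) 1 by rewrite (vge_nval _ vp).
have v2y : vge v (2%:R * y) 1 by apply: (vgeMl HK) => //; apply: (vge_nat HK).
have : vge v (3%:R : K) 2.
  rewrite e3 (vgeN HK); apply: (vgeD HK).
    by apply: (vgeM HK v3) (_ : vge v _ 1) _ => //; apply: (vgeMr HK) => //; apply: vge_le hy.
  apply: (vgeM HK hy) (_ : vge v _ 1) _ => //; apply: (vgeD HK).
    by apply: (vgeMr HK) => //; apply: vge_le v2y.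
  by apply: (vgeMr HK) => //; apply: vge_le hy.
by rewrite (vge_nval _ vp).
Qed.

(** This is the norm form of Z_2[i] or Z_3[zeta_3]. If its value had valuation 2 or more, (r + 1)^2
    for p = 2, or (2 r - t)^2 for p = 3, would have valuation 1. *)
Lemma exceptional_norm (t r : K) : v p%:R = Some 1 ->
  (p = 2%N /\ t = 0) \/ (p = 3%N /\ t ^+ 2 = 1) ->
  ~ vge v (r ^+ 2 - t * r + 1) 2.
Proof.
move=> vp ex h.
have t0 : vge v t 0.
  by case: ex => [[_ ->]|[_ e]]; [exact: (vge_zero HK) | apply: sqr_integral; rewrite e (vge1 HK)].
have r0 : vge v r 0.
  by apply: (vge_monic2 HK t0 (_ : vge v 1 0)); [rewrite (vge1 HK) | apply: vge_le h].
case: ex => [[p2 te]|[p3 te]].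
  rewrite te mul0r subr0 in h; rewrite p2 in vp.
  have vr : v r = Some 0.
    apply: vge_unit_nval => //; apply/negP => hr.
    have : vge v (1 : K) 1; last by rewrite (vge1 HK).
    have -> : 1 = (r ^+ 2 + 1) - r * r by ring.
    by apply: (vgeB HK); [apply: vge_le h | apply: (vgeMr HK)].
  have e : v (2%:R * r + (r ^+ 2 + 1)) = Some 1.
    by apply: (nval_dom HK) h; rewrite (nvalM HK vp vr).
  by apply: (nval_neq_odd HK (x := r + 1) (k := 0) e); ring.
rewrite p3 in vp.
have e : v (- 3%:R + 4%:R * (r ^+ 2 - t * r + 1)) = Some 1.
  by apply: (nval_dom HK); [rewrite (nvalN HK) | apply: (vgeMl HK) h; apply: (vge_nat HK)].
apply: (nval_neq_odd HK (x := 2%:R * r - t) (k := 0) e).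
have -> : - 3%:R = t ^+ 2 - 4%:R :> K by rewrite te; ring.
by ring.
Qed.

Lemma lat_eq_intmx_conj M M' g : isvert M -> isvert M' -> lat_eq v M M' ->
  intmx v (conjm M' g) -> intmx v (conjm M g).
Proof.
move=> hM hM' [c [c0 [h1 h2]]] hg; set N := invmx M *m (c *: M') in h1 h2.
have dN : \det N != 0.
  by rewrite det_mulmx det_inv detZ !mulf_neq0 ?invr_eq0 ?expf_neq0.
have E : M *m N = c *: M' by rewrite mulmxA mulmxV ?unitmx_det // mul1mx.
have -> : conjm M g = N *m conjm M' g *m invmx N; last by do 2?apply: (intmxM HK).
rewrite -[LHS](conjmVK _ dN) -conjm_comp // E; congr (_ *m _ *m _).
rewrite /conjm invmxZ ?scaler_unit ?unitfE ?unitmx_det //.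
by rewrite -!scalemxAl -scalemxAr scalerA mulVf ?scale1r.
Qed.

(** By cyclicity the trace is that of B^-1 A B times A^-1, and both factors stabilise the lattice of
    M. *)
Lemma tr_comm_integral M : isvert M -> intmx v (conjm M A) ->
  intmx v (conjm (B *m M) A) -> vge v (\tr (comm A B)) 0.
Proof.
move=> hM iA iBA; have uB : B \in unitmx by rewrite unitmx_det hB oner_neq0.
have -> : \tr (comm A B) = \tr (invmx B *m A *m B *m invmx A).
  by rewrite /comm mxtrace_mulC !mulmxA.
rewrite -(tr_conjm _ hM) conjmM //; apply: (intmx_tr HK); apply: (intmxM HK).
  have -> : conjm M (invmx B *m A *m B) = conjm (B *m M) A.
    by rewrite /conjm invmx_mul ?hB ?oner_neq0 // !mulmxA.
  by [].
by rewrite conjm_inv //; apply: (intmx_inv HK) => //; rewrite det_conjm // hA (nval1 HK).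
Qed.

Lemma axis_tr_comm_integral f l (i0 : int) : hyp_axis v B f l ->
  (forall i : int, fixes v A (f i) <-> (i0 <= i /\ i <= i0 + l%:Z)) ->
  vge v (\tr (comm A B)) 0.
Proof.
move=> [[fv _] [_ fB]] hf.
(* Since B carries f(i0) to f(i0 + l), A fixes f(i0) and its image under B. *)
have f1 : intmx v (conjm (f i0) A) by apply/(fixesP HK hA (fv _)); apply/hf; lia.
have f2 : intmx v (conjm (f (i0 + l%:Z)) A) by apply/(fixesP HK hA (fv _)); apply/hf; lia.
apply: (tr_comm_integral (fv i0) f1); apply: (lat_eq_intmx_conj _ (fv _) (fB i0) f2).
by rewrite /isvert det_mulmx hB mul1r; apply: fv.
Qed.

(* Both matrices are upper triangular modulo the maximal ideal, with the same
   diagonal, so their commutator is residually unipotent. *)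
Lemma tr_comm_iwahori a b c d b' c' : a * d - b * c = 1 -> a * d - b' * c' = 1 ->
  vge v a 0 -> vge v b 0 -> vge v d 0 -> vge v b' 0 -> vge v c 1 -> vge v c' 1 ->
  vge v (\tr (comm (mat2 a b c d) (mat2 a b' c' d)) - 2%:R) 1.
Proof.
move=> h h' ha hb hd hb' hc hc'.
rewrite tr_comm ?det_mat2 // mul_mat2 !tr_mat2.
(* z is the difference between the trace of the product of the two matrices and the trace of the
   square of the first; the Fricke identity then factors through z. *)
pose z := b * c' + c * b' - 2%:R * (b * c).
have had : a * d = 1 + b * c by rewrite -h; ring.
have -> : (a + d) ^+ 2 - (a + d) * (a + d) * (a * a + b * c' + (c * b' + d * d)) +
  (a * a + b * c' + (c * b' + d * d)) ^+ 2 + ((a + d) ^+ 2 - 4%:R) =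
  z * ((a + d) ^+ 2 - 4%:R + z).
  by rewrite /z; ring: had.
have hz : vge v z 1.
  apply: (vgeB HK); first by apply: (vgeD HK); [apply: (vgeMl HK) | apply: (vgeMr HK)].
  by apply: (vgeMl HK); [apply: (vge_nat HK) | apply: (vgeMl HK)].
apply: (vgeMr HK hz); apply: (vgeD HK); last by apply: vge_le hz.
apply: (vgeB HK); last exact: (vge_nat HK).
by apply: (vgeXint HK); apply: (vgeD HK).
Qed.

Hypothesis Hnonel : ~ elementary v (gen A B).
Hypothesis Hp : is_Qp v \/ ~ (exists g, gen A B g /\ g ^+ p = 1%:M /\ g != 1%:M).

Lemma traces_not_integral : vge v (\tr A) 0 -> vge v (\tr B) 0 ->
  vge v (\tr (A *m B)) 0 -> False.
Proof.
move=> tA tB tAB; have [M [hM iA iB]] := common_vertex HK hA hB tA tB tAB.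
apply: Hnonel; left; exists M; split=> // g gg.
by apply/(fixesP HK (gen_det1 hA hB gg) hM); exact: (gen_fixes_vertex HK hA hB hM iA iB gg).
Qed.

Lemma runip_trivial_or_small g : gen A B g -> runip v g ->
  g = 1 \/ (is_Qp v /\ (p <= 3)%N).
Proof.
move=> gg rg; case: Hp => [HQp | np]; last by left; apply: (runip_trivial HK Hdisc np).
have [->|g1] := eqVneq g 1; [by left | right; split=> //].
have [j [h1 h2 _]] := exists_order_p (runip_torsion HK Hdisc gg rg) g1.
by case: (Qp_order_p HK HQp (runipX HK _ rg) h2 h1) => [[->]|[->]].
Qed.

End TwoGenerators.

(** * The frame of a hyperbolic generator *)
Section Main.
Variables (K : fieldType) (v : K -> option int) (p : nat).
Hypothesis HK : nonarch_local_field v p.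
Variables (A B : 'M[K]_2).
Hypotheses (hA : \det A = 1) (hB : \det B = 1) (Hdisc : discrete v (gen A B)).
Hypothesis Hnonel : ~ elementary v (gen A B).
Hypothesis Hp : is_Qp v \/ ~ (exists g, gen A B g /\ g ^+ p = 1%:M /\ g != 1%:M).
Variable pi : K.
Hypothesis hpi : v pi = Some 1.

Section Frame.
Variables (P : 'M[K]_2) (x a b c d : K) (n : nat).
Hypotheses (hP : isvert P) (n0 : (0 < n)%N) (ex : v x = Some n%:Z).
Hypotheses (eB : conjm P B = mat2 x^-1 0 0 x) (eA : conjm P A = mat2 a b c d).

Let x0 : x != 0. Proof. exact: (neq0_nval HK ex). Qed.
Let evx : v x^-1 = Some (- n%:Z). Proof. exact: (nvalV HK ex). Qed.

Lemma frame_det : a * d = 1 + b * c.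
Proof. by have := det_conjm A hP; rewrite hA eA det_mat2 => <-; ring. Qed.

Lemma frame_trA : \tr A = a + d.
Proof. by rewrite -(tr_conjm A hP) eA tr_mat2. Qed.

Lemma frame_trB : \tr B = x^-1 + x.
Proof. by rewrite -(tr_conjm B hP) eB tr_mat2. Qed.

Lemma frame_nval_trB : v (\tr B) = Some (- n%:Z).
Proof.
by rewrite frame_trB; apply: (nval_dom HK evx); rewrite (vge_nval _ ex); lia.
Qed.

Lemma frame_tr_comm : \tr (comm A B) - 2%:R = - (b * c) * (x^-1 - x) ^+ 2.
Proof.
rewrite tr_comm // frame_trA frame_trB -(tr_conjm (A *m B) hP) conjmM // eA eB.
rewrite mul_mat2 tr_mat2; have had := frame_det.
have : x * x^-1 = 1 by rewrite mulfV.
by move: x^-1 => y hxy; ring: had hxy.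
Qed.

(** Otherwise A and B share an eigenvector and G fixes an end. If b = 0, the swap S of the two
    columns makes both matrices upper triangular. *)
Lemma frame_bc_neq0 : b != 0 /\ c != 0.
Proof.
split; apply/eqP => e0; apply: Hnonel.
  pose S := mat2 (0 : K) 1 1 0.
  have dS : \det S = -1 by rewrite det_mat2 mul0r mul1r sub0r.
  have dS0 : \det S != 0 by rewrite dS oppr_eq0 oner_neq0.
  have conjS w y z t : conjm S (mat2 w y z t) = mat2 t z y w.
    rewrite /conjm invmx_mat2 ?mul0r ?mul1r ?sub0r ?oppr_eq0 ?oner_neq0 //.
    by rewrite invrN1 scale_mat2 !mul_mat2; congr mat2; ring.
  apply: (elementary_upper HK hpi (P := P *m S)) => //.
  - by rewrite /isvert det_mulmx mulf_neq0.
  - by rewrite conjm_comp // eA conjS mxE.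
  - by rewrite conjm_comp // eB conjS mxE.
apply: (elementary_upper HK hpi hA hB hP); first by rewrite eA mxE.
by rewrite eB mxE.
Qed.

Lemma frame_nval_tr_comm m : v (b * c) = Some m ->
  v (\tr (comm A B) - 2%:R) = Some (m - n.*2%:Z).
Proof.
move=> em; rewrite frame_tr_comm.
have e1 : v (x^-1 - x) = Some (- n%:Z).
  by apply: (nval_dom HK evx); rewrite (vgeN HK) (vge_nval _ ex); lia.
have e2 : v (- (b * c)) = Some m by rewrite (nvalN HK).
by rewrite (nvalM HK e2 (nvalX HK 2 e1)); congr Some; lia.
Qed.

Lemma frame_A_neq1 : A != 1.
Proof.
have [b0 _] := frame_bc_neq0.
apply/eqP => e; move: eA; rewrite e conjm_scalar // scalar_mat2.
by move=> /mat2_inj [_ /esym/eqP]; rewrite (negbTE b0).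
Qed.

Hypothesis hD : vge v (\tr (comm A B) - 2%:R) 0.

Lemma frame_nval_bc_ge m : v (b * c) = Some m -> n.*2%:Z <= m.
Proof. by move=> em; move: hD; rewrite (vge_nval _ (frame_nval_tr_comm em)); lia. Qed.

Lemma frame_disc_unit : vge v (\tr A ^+ 2 - 4%:R) 0 -> v (\tr A ^+ 2 - 4%:R) = Some 0.
Proof.
move=> ht; apply: vge_unit_nval => //; apply/negP => h1.
have [b0 _] := frame_bc_neq0.
have r2 := runip_sqr HK hA h1.
have g2 : gen A B (A ^+ 2) by apply: genX; apply: genA.
(* Here (tr A) A = 2, and the nonzero entry b forces tr A = 0. *)
have sq1 : A ^+ 2 = 1 -> \tr A = 0 /\ 2%:R = 0 :> K.
  rewrite expr2 -mulmxE cayley_hamilton2 hA => /eqP; rewrite subr_eq => /eqP e.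
  have := congr1 (conjm P) e; rewrite conjmZ conjmD !conjm_scalar // eA.
  rewrite scalar_mat2 add_mat2 scale_mat2 => /mat2_inj [e1 e2 _ _].
  move/eqP: e2; rewrite addr0 mulf_eq0 (negbTE b0) orbF => /eqP tA.
  by split=> //; rewrite mulr2n -e1 tA mul0r.
have neq1 : is_Qp v -> A ^+ 2 != 1.
  by move=> HQp; apply/eqP => /sq1 [_ /eqP]; apply/negP; apply: (natr_neq0 HQp (n := 2)).
have sqc : is_Qp v -> False.
  move=> HQp; have ex' := Qp_exceptional HK hA hB Hdisc HQp (genA _ _) h1 (neq1 HQp).
  pose s := \tr B; pose u := \tr (A *m B).
  have es : v s = Some (- n%:Z) := frame_nval_trB.
  have s0 := neq0_nval HK es.
  apply: (exceptional_norm HK (r := u / s) (Qp_nval_p HK HQp) ex').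
  (* The Fricke identity divided by s^2, where v(s^-2) = 2n. *)
  have -> : (u / s) ^+ 2 - \tr A * (u / s) + 1 = s ^- 2 *
    ((\tr (comm A B) - 2%:R) - (\tr A ^+ 2 - 4%:R)).
    by rewrite tr_comm // -/s -/u; field.
  apply: (vgeM HK) (_ : vge v _ n.*2%:Z) (vgeB HK hD ht) _; last by lia.
  by rewrite (vge_nval _ (nvalV HK (nvalX HK 2 es))); lia.
case: Hp => [// | np].
have e1 := runip_trivial HK Hdisc np g2 r2.
have [_ two0] := sq1 e1.
(* Without Q_p, 2 = 0 in K leaves p = 2, and A itself has order p. *)
have p2 : p = 2%N.
  have [cp|] := boolP (coprime p 2).
    by have /(neq0_nval HK) := nval_coprime HK cp; rewrite two0 eqxx.
  rewrite prime_coprime ?(nlf_prime HK) // negbK dvdn_prime2 ?(nlf_prime HK) //.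
  by move/eqP.
apply: np; exists A; rewrite p2; split; [exact: genA | split=> //].
exact: frame_A_neq1.
Qed.

Hypothesis hdisc : v (\tr A ^+ 2 - 4%:R) = Some 0.

Lemma frame_diag_int : vge v a 0 /\ vge v d 0.
Proof.
have ht : vge v (\tr A) 0 by apply: (tr_integral HK); rewrite (vge_nval _ hdisc).
have [b0 c0] := frame_bc_neq0; have [m em] := nval_neq0 HK (mulf_neq0 b0 c0).
have hbc : vge v (a * d) 0.
  rewrite frame_det; apply: (vgeD HK); first by rewrite (vge1 HK).
  by rewrite (vge_nval _ em); have := frame_nval_bc_ge em; lia.
rewrite frame_trA in ht; split; first exact: (vge_sum_prod HK ht hbc).
by apply: (vge_sum_prod HK (y := a)); rewrite 1?addrC 1?mulrC.
Qed.

Lemma frame_nval_bc : v (b * c) = Some n.*2%:Z.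
Proof.
have [ha hd] := frame_diag_int; have [b0 c0] := frame_bc_neq0.
have [m em] := nval_neq0 HK (mulf_neq0 b0 c0).
have hm := frame_nval_bc_ge em; rewrite em; congr Some; apply/eqP.
apply: contraT => nem; have {nem}hm : n.*2%:Z + 1 <= m by lia.
have [k ek] := nval_neq0 HK b0; have [l el] := nval_neq0 HK c0.
have ekl : m = k + l by have := nvalM HK ek el; rewrite em => -[].
have hbc : vge v (b * c) 1 by rewrite (vge_nval _ em); lia.
exfalso.
have had := frame_det.
(* Here ad = 1 modulo the maximal ideal; if also a^2 = 1 there, then a = d and t^2 - 4 vanishes
   residually. *)
have small : ~ (is_Qp v /\ (p <= 3)%N).
  move=> [HQp p3].
  have va : v a = Some 0.
    apply: vge_unit_nval => //; apply/negP => ha1.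
    have : vge v (1 : K) 1; last by rewrite (vge1 HK).
    have -> : 1 = a * d - b * c by rewrite had; ring.
    by apply: (vgeB HK) => //; apply: (vgeMr HK).
  have a2 := Qp_unit_sqr HK HQp p3 va.
  have hadiff : vge v (a - d) 1.
    have -> : a - d = (a ^+ 2 - 1) * d - a * (b * c).
      have -> : b * c = a * d - 1 by rewrite had; ring.
      by ring.
    by apply: (vgeB HK); [apply: (vgeMr HK) | apply: (vgeMl HK)].
  have : vge v (\tr A ^+ 2 - 4%:R) 1; last by rewrite (vge_nval _ hdisc).
  have -> : \tr A ^+ 2 - 4%:R = (a - d) * (a - d) + 4%:R * (b * c).
    have -> : b * c = a * d - 1 by rewrite had; ring.
    by rewrite frame_trA; ring.
  apply: (vgeD HK); last by apply: (vgeMl HK) => //; apply: (vge_nat HK).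
  by apply: (vgeMr HK) => //; apply: vge_le hadiff.
pose A' := B *m A *m invmx B.
have dA' : \det A' = 1 by rewrite !det1_mul ?det1_inv.
have gA' : gen A B A' by apply: genM; [apply: genM; [apply: genB | apply: genA] | apply: genBi].
have eBi : conjm P (invmx B) = mat2 x 0 0 x^-1.
  rewrite conjm_inv // eB invmx_mat2 ?mulVf ?mul0r ?subr0 ?oner_neq0 //.
  by rewrite invr1 scale1r !oppr0.
have eA' : conjm P A' = mat2 a (b * x^-1 ^+ 2) (c * x ^+ 2) d.
  rewrite /A' !conjmM // eB eA eBi !mul_mat2.
  by congr mat2; field.
(* A fixes the indices from - k to l and A' those from 2n - k to l + 2n. The index i is the left end
   of the overlap, and i < l puts both lower left entries in the maximal ideal. *)
pose i := n.*2%:Z - k.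
have eAi := conjm_apt HK hpi i hP eA; have eAi' := conjm_apt HK hpi i hP eA'.
pose W := comm A A'.
have gW : gen A B W.
  apply: genM; last first.
    rewrite /A' !invmx_mul ?det1_mul ?det1_inv ?hA ?hB ?oner_neq0 // invmxK.
    by apply: genM; [apply: genB | apply: genM; [apply: genAi | apply: genBi]].
  by apply: genM; [apply: genM; [apply: genA | ] | apply: genAi].
clearbody A'.
have vertPi := apt_vert HK hpi i hP.
have [i1 i2 i3 i4] : [/\ 1 <= l - i, 1 <= l + n%:Z * 2%:Z - i, 0 <= k + i
    & 0 <= k + - n%:Z * 2%:Z + i].
  by move: hm; rewrite ekl /i; clear; split; lia.
have v1 : vge v (c * pi ^ (- i)) 1.
  by rewrite (vge_nval _ (nvalM HK el (nval_piz HK hpi _))).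
have v2 : vge v (c * x ^+ 2 * pi ^ (- i)) 1.
  by rewrite (vge_nval _ (nvalM HK (nvalM HK el (nvalX HK 2 ex)) (nval_piz HK hpi _))).
have v3 : vge v (b * pi ^ i) 0.
  by rewrite (vge_nval _ (nvalM HK ek (nval_piz HK hpi _))).
have v4 : vge v (b * x^-1 ^+ 2 * pi ^ i) 0.
  by rewrite (vge_nval _ (nvalM HK (nvalM HK ek (nvalX HK 2 evx)) (nval_piz HK hpi _))).
have rW : runip v W.
  split; first by rewrite /W /comm !det1_mul ?det1_inv.
    rewrite -(tr_conjm W vertPi) /W /comm !conjmM // !conjm_inv // eAi eAi'.
    by apply: (tr_comm_iwahori HK) => //;
      rewrite -det_mat2 -?eAi -?eAi' det_conjm.
  exists (apt pi P i); split=> //.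
  have iA : intmx v (conjm (apt pi P i) A).
    by rewrite eAi; apply/intmx_mat2; split=> //; apply: vge_le v1.
  have iA' : intmx v (conjm (apt pi P i) A').
    by rewrite eAi'; apply/intmx_mat2; split=> //; apply: vge_le v2.
  have inv g : \det g = 1 -> intmx v (conjm (apt pi P i) g) ->
      intmx v (conjm (apt pi P i) (invmx g)).
    move=> hg ig; rewrite conjm_inv //; apply: (intmx_inv HK) => //.
    by rewrite det_conjm // hg (nval1 HK).
  rewrite /W /comm !conjmM //.
  apply: (intmxM HK) (inv _ dA' iA'); apply: (intmxM HK) (inv _ hA iA).
  exact: (intmxM HK iA iA').
have W1 : W = 1 by case: (runip_trivial_or_small HK Hdisc Hp gW rW) => // /small.
have AA : A *m A' = A' *m A.
  have uA : A \in unitmx by rewrite unitmx_det hA oner_neq0.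
  have uA' : A' \in unitmx by rewrite unitmx_det dA' oner_neq0.
  rewrite -[LHS](mulmxKV uA) -[A *m A' *m invmx A](mulmxKV uA').
  by rewrite -/(comm A A') -/W W1 mul1mx.
have := congr1 (conjm P) AA; rewrite !conjmM // eA eA' !mul_mat2 => /mat2_inj [e00 _ _ _].
(* The top left entries of AA' and A'A give bc x^2 = bc x^-2, absurd since v x > 0. *)
have e4 : x ^+ 4 = 1.
  apply: (mulfI (mulf_neq0 b0 c0)).
  have : b * (c * x ^+ 2) = b * x^-1 ^+ 2 * c by apply: (addrI (a * a)).
  move=> /(congr1 (fun z => z * x ^+ 2)) e5; rewrite mulr1.
  transitivity (b * (c * x ^+ 2) * x ^+ 2); first by ring.
  by rewrite e5; field.
have := nvalX HK 4 ex; rewrite e4 (nval1 HK) => -[].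
by move: n0; clear; lia.
Qed.

Lemma frame_axis : exists (f : int -> 'M[K]_2) (l : nat), hyp_axis v B f l /\
  exists i0 : int, forall i : int,
    fixes v A (f i) <-> (i0 <= i /\ i <= i0 + l%:Z).
Proof.
have [ha hd] := frame_diag_int; have [b0 c0] := frame_bc_neq0.
have ebc := frame_nval_bc.
have [k ek] := nval_neq0 HK b0; have [l el] := nval_neq0 HK c0.
have ekl : n.*2%:Z = k + l by have := nvalM HK ek el; rewrite ebc => -[].
exists (apt pi P), n.*2; split.
  split; first exact: (geod_line_apt HK hpi).
  split; first by rewrite double_gt0.
  (* B acts on the frame as x^-1 diag(1, x^2), so up to homothety it shifts the index by v(x^2) =
     2n. *)
  move=> i; apply: (lat_eqI HK (c := x^-1)); rewrite ?invr_eq0 //.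
    rewrite (apt_rel HK hpi _ _ _ hP hB eB) mulVf //.
    apply/intmx_mat2; rewrite !(mulr0, mul0r) (vge1 HK) !(vge_zero HK); split=> //.
    rewrite (vge_nval _ (nvalM HK (nvalM HK evx evx) (nval_piz HK hpi _))); lia.
  rewrite (apt_rel HK hpi _ _ _ hP hB eB) mulVf // det_mat2 !(mulr0, mul0r, mul1r, subr0).
  by rewrite (nvalM HK (nvalM HK evx evx) (nval_piz HK hpi _)); congr Some; lia.
(* The off-diagonal entries are integral for - k <= i <= l, and k + l = 2n makes this path as long
   as the translation. *)
exists (- k) => i.
have e1 := nvalM HK ek (nval_piz HK hpi i).
have e2 := nvalM HK el (nval_piz HK hpi (- i)).
split.
  move=> /(fixesP HK hA (apt_vert HK hpi i hP)); rewrite (conjm_apt HK hpi i hP eA).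
  by move=> /intmx_mat2 [_ + + _]; rewrite (vge_nval _ e1) (vge_nval _ e2); lia.
move=> [h1 h2]; apply/(fixesP HK hA (apt_vert HK hpi i hP)).
rewrite (conjm_apt HK hpi i hP eA); apply/intmx_mat2.
by rewrite (vge_nval _ e1) (vge_nval _ e2); split=> //; lia.
Qed.
End Frame.

(** Since v(t^2 - 4) comes out as exactly 0, this bounds the minimum by 0 and also describes the
    case of equality. *)
Lemma integral_traces_axis :
  vge v (\tr A ^+ 2 - 4%:R) 0 -> vge v (\tr (comm A B) - 2%:R) 0 ->
  v (\tr A ^+ 2 - 4%:R) = Some 0 /\
  (exists (f : int -> 'M[K]_2) (l : nat), hyp_axis v B f l /\
    exists i0 : int, forall i : int,
      fixes v A (f i) <-> (i0 <= i /\ i <= i0 + l%:Z)).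
Proof.
move=> ht hD; have tA := tr_integral HK ht.
have tB : ~~ vge v (\tr B) 0.
  apply/negP => tB; apply: (traces_not_integral HK hA hB Hnonel tA tB).
  (* For integral t and s, the Fricke identity is a monic quadratic equation for tr(AB) with
     integral coefficients. *)
  apply: (vge_monic2 HK (b := \tr A * \tr B) (c := \tr B ^+ 2)).
  - exact: (vgeMl HK).
  - exact: (vgeXint HK).
  - have -> : \tr (A *m B) ^+ 2 - \tr A * \tr B * \tr (A *m B) + \tr B ^+ 2 =
      (\tr (comm A B) - 2%:R) - (\tr A ^+ 2 - 4%:R) by rewrite tr_comm //; ring.
    exact: (vgeB HK).
have [P [x [n [hP n0 ex eB]]]] := diagonalize_hyp HK hB tB.
have eA := mat2_eta (conjm P A).
have hu := frame_disc_unit hP n0 ex eB eA hD ht.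
by split=> //; apply: frame_axis hP n0 ex eB eA hD hu.
Qed.
End Main.

Theorem theorem1p2 (K : fieldType) (v : K -> option int) (p : nat)
  (HK : nonarch_local_field v p) (A B : 'M[K]_2)
  (hA : \det A = 1) (hB : \det B = 1)
  (Hdisc : discrete v (gen A B)) (Hnonel : ~ elementary v (gen A B))
  (Hp : is_Qp v \/ ~ (exists g, gen A B g /\ g ^+ p = 1%:M /\ g != 1%:M)) :
  let m := omin (v ((\tr A) ^+ 2 - 4%:R)) (v (\tr (comm A B) - 2%:R)) in
  ole m (Some 0) /\
  (m = Some 0 <->
     (elliptic v A /\ (exists n : nat, (0 < n)%N /\ A ^+ n = 1%:M)) /\
     (exists (f : int -> 'M[K]_2) (l : nat), hyp_axis v B f l /\
        exists i0 : int, forall i : int,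
          fixes v A (f i) <-> (i0 <= i /\ i <= i0 + l%:Z))).
Proof.
move=> m; have [pi hpi] := nlf_surj HK 1.
have key := integral_traces_axis HK hA hB Hdisc Hnonel Hp hpi.
have ominE (k : int) : ole (Some k) m =
    vge v (\tr A ^+ 2 - 4%:R) k && vge v (\tr (comm A B) - 2%:R) k.
  rewrite /m /vge /omin; case: (v _) => [y|]; case: (v _) => [z|] //=;
    rewrite ?andbT //; case: ifP => /=; lia.
have mle : ole m (Some 0).
  suff : ~~ ole (Some 1) m by case: m {ominE} => [k|] //=; lia.
  rewrite ominE; apply/negP => /andP[h1 h2].
  have [e _] := key (vge_le (n := 0) ler01 h1) (vge_le (n := 0) ler01 h2).
  by move: h1; rewrite (vge_nval _ e).
split=> //; split.
  move=> em; have := ominE 0; rewrite em /= lexx => /esym/andP[h1 h2].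
  have [_ hax] := key h1 h2; split=> //; have tA := tr_integral HK h1.
  split; last exact: (finite_order HK hA hB Hdisc (genA A B) tA).
  have [M [hM iM]] := integral_conj HK hA tA.
  by exists M; split=> //; apply/(fixesP HK hA hM).
(* Ellipticity makes t^2 - 4 integral and the fixed path makes tr [A,B] integral; so 0 <= m, and the
   bound already proved gives m = 0. *)
move=> [[ellA _] [f [l [hax [i0 hi0]]]]].
have h1 : vge v (\tr A ^+ 2 - 4%:R) 0.
  apply: (vgeB HK); last exact: (vge_nat HK).
  by apply: (vgeXint HK); apply: (elliptic_tr HK hA ellA).
have h2 : vge v (\tr (comm A B) - 2%:R) 0.
  apply: (vgeB HK); last exact: (vge_nat HK).
  exact: (axis_tr_comm_integral HK hA hB hax hi0).
have := ominE 0; rewrite h1 h2 /=; move: mle.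
by case: (m) => //= k k1 k2; congr Some; lia.
Qed.
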